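(* Let $p \geq 2$ be fixed, let $q$ be defined by $\frac1p+\frac1q=1$, and let $\{\lambda_k\}_{k=1}^{\infty}$ be a non-decreasing sequence of positive real numbers, with partial sums $\Lambda_n=\sum_{i=1}^n\lambda_i$. Put $$L=\sup_{n\ge 1}\Big(\frac{\Lambda_{n+1}}{\lambda_{n+1}}-\frac{\Lambda_n}{\lambda_n}\Big)$$ and suppose that all of the following hold: (i) $L\le 1$; (ii) $\sup_{k\ge 1}\frac{\lambda_{k+1}}{\lambda_k}<+\infty$; (iii) $\frac{\lambda_k}{\lambda_{k+1}}=1-\frac{1/L-1}{k}+O\big(\frac1{k^2}\big)$ as $k\to\infty$; (iv) $\frac{\lambda_k}{\Lambda_k}=\frac{1}{Lk}+O\big(\frac1{k^2}\big)$ as $k\to\infty$; (v) $\inf_{k\ge 1}\Big(\frac{\Lambda_{k+1}}{\lambda_{k+1}}-\frac{\Lambda_k}{\lambda_k}\Big)>0$; (vi) for all $k\ge 1$, $\quad 1-\frac Lp\ \ge\ \frac{\Lambda_k}{\lambda_k}\Big(1-\Big(\frac{\Lambda_k}{\Lambda_{k+1}}\Big)^{\frac{p-1}{p}}\Big(\frac{\lambda_k}{\lambda_{k+1}}\Big)^{\frac1p}\Big)$. For each integer $N\ge1$ let $\mu_N$ denote the best (smallest) constant such that $$\sum_{n=1}^{N}\Big|\sum_{k=1}^{n}\frac{\lambda_k a_k}{\Lambda_n}\Big|^p\le \mu_N\sum_{n=1}^{N}|a_n|^p$$ holds for all sequences of non-negative real numbers $a_1,\dots,a_N$. Then, as $N\to+\infty$,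 $$\mu_N=\Big(1-\frac Lp\Big)^{-p}-\frac{2L^2\pi^2\,(1-L/p)^{-2-p}}{q(\log N)^2}+O\Big(\frac1{(\log N)^3}\Big).$$
   Context: Note that condition (v) forces $L>0$, so that conditions (iii) and (iv) make sense. The implied constant in the final $O$-term may depend on $p$ and on the sequence $\{\lambda_k\}$, but not on $N$. *)

(* Defs.v *)
From mathcomp Require Import all_boot all_order all_algebra.
From mathcomp Require Import all_classical all_reals all_analysis.

Set Implicit Arguments.
Unset Strict Implicit.
Unset Printing Implicit Defensive.

Import Order.TTheory GRing.Theory Num.Theory.
Import numFieldNormedType.Exports.

Local Open Scope classical_set_scope.
Local Open Scope ring_scope.

(* Sequences are indexed from 1: the value at 0 of a function on nat that
   stands for one is never used. *)

Definition partial_sum (R : realType) (lam : nat -> R) (n : nat) : R :=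
  \sum_(1 <= i < n.+1) lam i.

Definition ratio_gap (R : realType) (lam : nat -> R) (n : nat) : R :=
  partial_sum lam n.+1 / lam n.+1 - partial_sum lam n / lam n.

Definition hardy_constants (R : realType) (p : R) (lam : nat -> R) (N : nat) :
    set R :=
  [set c | forall a : nat -> R,
    (forall n, (1 <= n <= N)%N -> 0 <= a n) ->
    \sum_(1 <= n < N.+1)
       `|\sum_(1 <= k < n.+1) lam k * a k / partial_sum lam n| `^ p
    <= c * \sum_(1 <= n < N.+1) `|a n| `^ p].

(* The infimum is a minimum, see best_hardy_constantP. *)
Definition best_hardy_constant (R : realType) (p : R) (lam : nat -> R)
    (N : nat) : R :=
  inf (hardy_constants p lam N).

Section BestConstant.
Context {R : realType} (p : R) (lam : nat -> R) (N : nat).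
Context (p_gt0 : 0 < p).
Context (lam_gt0 : forall k, (1 <= k)%N -> 0 < lam k).
Context (N_gt0 : (1 <= N)%N).

Let S (a : nat -> R) := \sum_(1 <= n < N.+1) `|a n| `^ p.

Let S_ge0 a : 0 <= S a.
Proof. by apply: sumr_ge0 => n _; exact: powR_ge0. Qed.

Lemma hardy_constants_ge0 : lbound (hardy_constants p lam N) 0.
Proof.
move=> c /(_ (fun=> 1)) /(_ (fun _ _ => ler01)) h.
have S1 : 0 < S (fun=> 1).
  rewrite /S normr1 powR1 big_const_nat iter_addr_0 subn1 /=.
  by rewrite ltr0n.
rewrite -(pmulr_lge0 _ S1); apply: le_trans h.
by apply: sumr_ge0 => n _; exact: powR_ge0.
Qed.

Lemma hardy_constants_nonempty : hardy_constants p lam N !=set0.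
Proof.
exists (N%:R * N%:R `^ p) => a a0; rewrite -/(S a).
have aS k : (1 <= k <= N)%N -> `|a k| <= S a `^ p^-1.
  move=> kN; have : `|a k| `^ p <= S a.
    rewrite /S (bigD1_seq k) ?iota_uniq ?mem_index_iota //= lerDl.
    by apply: sumr_ge0 => n _; exact: powR_ge0.
  have pV_ge0 : 0 <= p^-1 by rewrite invr_ge0 ltW.
  move=> /(ge0_ler_powR pV_ge0); rewrite !nnegrE powR_ge0 S_ge0.
  by rewrite -powRrM mulfV ?gt_eqF// powRr1//; apply.
have term n : (1 <= n <= N)%N ->
    `|\sum_(1 <= k < n.+1) lam k * a k / partial_sum lam n| `^ p
    <= N%:R `^ p * S a.
  move=> /andP[n1 nN].
  have -> : N%:R `^ p * S a = (N%:R * S a `^ p^-1) `^ p.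
    rewrite powRM ?powR_ge0// -powRrM mulVf ?gt_eqF// powRr1//.
  apply: (ge0_ler_powR (ltW p_gt0)); rewrite ?nnegrE ?mulr_ge0 ?powR_ge0//.
  apply: le_trans (ler_norm_sum _ _ _) _.
  apply: (@le_trans _ _ (\sum_(1 <= k < n.+1) S a `^ p^-1)); last first.
    rewrite big_const_nat iter_addr_0 subn1 /= -[leLHS]mulr_natl.
    by rewrite ler_wpM2r ?powR_ge0// ler_nat.
  rewrite [leLHS]big_seq [leRHS]big_seq; apply: ler_sum => k.
  rewrite mem_index_iota ltnS => /andP[k1 kn].
  have L0 : 0 < partial_sum lam n.
    rewrite /partial_sum big_nat_recr//= ltr_wpDl ?lam_gt0//.
    rewrite big_seq; apply: sumr_ge0 => i.
    by rewrite mem_index_iota => /andP[i1 _]; rewrite ltW ?lam_gt0.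
  rewrite mulrAC normrM -[leRHS]mul1r ler_pM//.
    rewrite ger0_norm; last by rewrite divr_ge0 ?ltW ?lam_gt0.
    rewrite ler_pdivrMr// mul1r /partial_sum.
    rewrite (bigD1_seq k) ?iota_uniq ?mem_index_iota ?k1//= lerDl.
    rewrite big_seq_cond; apply: sumr_ge0 => i.
    by rewrite mem_index_iota => /andP[/andP[i1 _] _]; rewrite ltW ?lam_gt0.
  by apply: aS; rewrite k1 (leq_trans kn).
apply: (@le_trans _ _ (\sum_(1 <= n < N.+1) N%:R `^ p * S a)).
  rewrite [leLHS]big_seq [leRHS]big_seq; apply: ler_sum => n.
  by rewrite mem_index_iota => nN; exact: term.
by rewrite big_const_nat iter_addr_0 subn1 /= -[leLHS]mulr_natl mulrA.
Qed.

Lemma best_hardy_constantP :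
  hardy_constants p lam N (best_hardy_constant p lam N) /\
  lbound (hardy_constants p lam N) (best_hardy_constant p lam N).
Proof.
split; last by apply: ge_inf; exists 0; exact: hardy_constants_ge0.
move=> a a0; rewrite -/(S a).
have [S0|S0] := eqVneq (S a) 0.
  have [c /(_ a a0)] := hardy_constants_nonempty.
  by rewrite -/(S a) S0 !mulr0.
have {S0}S_gt0 : 0 < S a by rewrite lt_neqAle eq_sym S0 S_ge0.
rewrite -ler_pdivrMr//; apply: lb_le_inf; first exact: hardy_constants_nonempty.
by move=> c /(_ a a0); rewrite -/(S a) ler_pdivrMr.
Qed.

End BestConstant.

(* Main.v *)
Require Import Defs.
From mathcomp Require Import all_boot all_order all_algebra.
From mathcomp Require Import all_classical all_reals all_analysis.
From mathcomp Require Import ring lra.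

Set Implicit Arguments.
Unset Strict Implicit.
Unset Printing Implicit Defensive.

Import Order.TTheory GRing.Theory Num.Theory.
Import numFieldNormedType.Exports.

Local Open Scope classical_set_scope.
Local Open Scope ring_scope.

(** Write [X n] for [Lambda_n / lambda_n], [A n] for the weighted means of a
    sequence [a], and [W = 1 - L / p].

    By convexity, a lower bound [mu * (a_1 ^ p + ... + a_k ^ p) -
    (A_1 ^ p + ... + A_(k-1) ^ p) >= c_k * A_k ^ p] passes from [k] to [k + 1]
    with an explicit best [c_(k+1)], and there is exactly one choice of
    [a_(k+1)] that leaves no slack.  Hence [mu] is admissible for [N] exactly
    when the scalar orbit [c_1 = mu, c_2, ...] does not fall below [1] up to [N]
    ([hardy_constant_of_subsolution] and [riccati_gt0]).

    Put [c_k = 1 + mu * (X (k+1) - 1) * z_k], [1 / mu = W ^ p * (1 + eps)] and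
    [z_k = W ^ (p-1) * (1 + v_k)].  The orbit then follows approximately, with
    time steps [W / X (k+1)], the equation [v' = - (eps + speed v)], where
    [speed] is convex and vanishes to second order at [0], with quadratic
    coefficient [q / 2].  It starts on the right of [0] and is stopped at [-1].  Passing the
    bottleneck near [0] takes the time [pi / sqrt (eps * q / 2) + O(1)], while
    [W / L * ln N + O(1)] is available before [N], as [X k] is close to [L * k].
    Equating the two gives [eps = 2 * L^2 * pi^2 / (q * W^2 * (ln N)^2)] up to
    [O(1 / (ln N)^3)], which is the expansion.

    The relative precision [O(1 / ln N)] requires both times up to [O(1)].
    - The cubic term of the speed contributes an unbounded amount on each side
      of the bottleneck, but these amounts cancel.  An explicit primitive
      [travel_time], odd up to an even logarithmic term, accounts for it, and a
      multiple of [v] turns the remaining bounded error into one-sided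
      inequalities ([travel_time_bounds]).
    - An Euler step has a relative error of the order of its length, so the
      total error is a convergent sum ([euler_survival], [euler_extinction]).
    - The recursion differs from the Euler scheme by terms of order [X k ^ -2],
      which are not small compared with [eps / X k] for small [k].  For the
      upper estimate they have the right sign, by the Bernoulli inequality and
      [X (k+1) - X k <= L]: an Euler scheme is a subsolution
      ([euler_subsolution]).  For the lower estimate they are absorbed by
      shifting the position by a multiple of [1 / X (k+1)]
      ([riccati_shifted_step]). *)

(** * Inequalities and Taylor expansions of real powers *)

Section RealPowers.
Context {R : realType}.
Implicit Types a s x y v : R.

Lemma bernoulli_ge a x : 1 <= a -> 0 <= x -> 1 + a * (x - 1) <= x `^ a.
Proof.
rewrite le_eqVlt => /predU1P[<- x0|a1 x0]; first by rewrite powRr1//; lra.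
have a0 : 0 < a by lra.
have b0 : 0 < a - 1 by lra.
have := @conjugate_powR R x 1 a (a / (a - 1)) x0 ler01 a0 (divr_gt0 a0 b0).
rewrite powR1 invf_div mul1r mulr1 => /(_ _)/wrap[|].
  by field; rewrite gt_eqF.
rewrite -mulrDl ler_pdivlMr// => h.
by rewrite -(lerD2r (a - 1)); apply: le_trans h; lra.
Qed.

Lemma bernoulli_le s x : 0 < s <= 1 -> 0 <= x -> x `^ s <= 1 + s * (x - 1).
Proof.
move=> /andP[s0 s1] x0.
have : 1 <= s^-1 by rewrite invr_ge1 ?unitf_gt0.
move=> /bernoulli_ge/(_ (powR_ge0 x s)).
rewrite -powRrM mulfV ?gt_eqF// powRr1// => h.
rewrite -lerBlDl -ler_pdivrMl//.
by apply: le_trans (_ : x - 1 <= _); lra.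
Qed.

Lemma bernoulli_neg a x : 0 <= a -> 0 < x -> 1 + a * (1 - x) <= x `^ (- a).
Proof.
move=> a0 x0; rewrite /powR gt_eqF//; apply: le_trans (expR_ge1Dx _).
rewrite lerD2l mulNr -mulrN ler_wpM2l// lerNr opprB.
by rewrite -{1}(subrKC 1 x) le_ln1Dx//; lra.
Qed.

Lemma powR_ge_tangent a x y : 1 <= a -> 0 <= x -> 0 <= y ->
  y `^ a + a * y `^ (a - 1) * (x - y) <= x `^ a.
Proof.
move=> a1 x0; rewrite le_eqVlt => /predU1P[<-|y0].
  move: a1; rewrite le_eqVlt => /predU1P[<-|a1].
    by rewrite subrr powRr0 !powRr1//; lra.
  by rewrite !powR0 ?mulr0 ?mul0r ?addr0 ?powR_ge0//; apply/eqP; lra.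
have -> : x = x / y * y by rewrite divfK ?gt_eqF.
have xy0 : 0 <= x / y by rewrite divr_ge0// ltW.
rewrite powRM ?(ltW y0)// -mulr_powRB1 ?(ltW y0)//; last by lra.
have := bernoulli_ge a1 xy0.
set u := x / y; set w := y `^ (a - 1) => h.
have -> : y * w + a * w * (u * y - y) = (1 + a * (u - 1)) * (y * w) by ring.
by rewrite ler_wpM2r// mulr_ge0 ?powR_ge0// ltW.
Qed.

Lemma powR_near1_bound s v : `|v| <= 2^-1 -> (1 + v) `^ s <= expR `|s|.
Proof.
rewrite ler_norml => /andP[v1 v2].
have v0 : 0 < 1 + v by lra.
rewrite /powR gt_eqF// ler_expR; apply: le_trans (ler_norm _) _.
rewrite normrM ler_piMr// ler_norml; apply/andP; split; last first.
  by rewrite (le_trans (le_ln1Dx _))//; lra.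
rewrite lerNl -lnV ?posrE//.
have -> : (1 + v)^-1 = 1 + ((1 + v)^-1 - 1) by ring.
have vV : (1 + v)^-1 <= 2.
  by rewrite -[leRHS]invrK lef_pV2 ?posrE ?invr_gt0 ?ltr0n//; lra.
rewrite (le_trans (le_ln1Dx _))//; last by lra.
by rewrite -subr_gt0 opprK subrK invr_gt0.
Qed.

Lemma mean_value (h dh : R -> R) (a b : R) : a <= b ->
  (forall x : R, a <= x <= b -> is_derive x 1 h (dh x)) ->
  exists2 c, a <= c <= b & h b - h a = dh c * (b - a).
Proof.
move=> ab hd; have [||c] := @MVT_segment R h dh a b ab.
- by move=> x; rewrite in_itv/= => /andP[ax xb]; apply: hd; rewrite !ltW.
- apply: derivable_within_continuous => x; rewrite in_itv/= => xab.
  by apply: ex_derive; exact: hd.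
by rewrite in_itv/= => cab e; exists c.
Qed.

(** One antidifferentiation step: it raises the order of vanishing at the
    origin by one. *)
Lemma norm_le_of_deriv (h dh : R -> R) (n : nat) (C r : R) :
  (forall x : R, `|x| <= r -> is_derive x 1 h (dh x)) -> h 0 = 0 ->
  (forall x, `|x| <= r -> `|dh x| <= C * `|x| ^+ n) -> 0 <= C ->
  forall x, `|x| <= r -> `|h x| <= C * `|x| ^+ n.+1.
Proof.
move=> hd h0 hb C0 x xr.
have step y : `|y| <= `|x| -> `|dh y * x| <= C * `|x| ^+ n.+1.
  move=> yx; rewrite normrM exprSr mulrA ler_wpM2r//.
  rewrite (le_trans (hb _ (le_trans yx xr)))//.
  by rewrite ler_wpM2l// lerXn2r ?nnegrE.
have [x0|x0] := leP 0 x.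
  have [y yx|y] := @mean_value h dh 0 x x0.
    apply: hd; apply: le_trans xr; rewrite !ger0_norm//;
    by move: yx => /andP[].
  rewrite h0 !subr0 => /andP[y0 yx] ->; apply: step.
  by rewrite !ger0_norm.
have [y xy|y] := @mean_value h dh x 0 (ltW x0).
  apply: hd; apply: le_trans xr; move: xy => /andP[xy y0].
  by rewrite !ler0_norm ?(ltW x0)//; lra.
rewrite h0 !sub0r => /andP[xy y0] e.
rewrite -normrN e mulrN normrN; apply: step.
by rewrite !ler0_norm ?(ltW x0)//; lra.
Qed.

Definition gbinom s (n : nat) : R := (\prod_(i < n) (s - i%:R)) / n`!%:R.

Lemma gbinom0 s : gbinom s 0 = 1.
Proof. by rewrite /gbinom big_ord0 divr1. Qed.

Lemma gbinomS s n : gbinom s n.+1 * n.+1%:R = s * gbinom (s - 1) n.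
Proof.
rewrite /gbinom big_ord_recl/= subr0 factS natrM.
rewrite (eq_bigr (fun i : 'I_n => s - 1 - i%:R)); last first.
  by move=> i _; rewrite /bump/= natrD; ring.
by field; rewrite addrC natr1 !pnatr_eq0 -lt0n fact_gt0.
Qed.

(** Binomial series with remainder: differentiating the remainder of order
    [n.+1] for the exponent [s] gives [s] times that of order [n] for [s - 1],
    so the bound is obtained by integrating [n] times a bounded function. *)
Lemma powR_taylor (n : nat) s : exists2 C, 0 <= C & forall v, `|v| <= 2^-1 ->
  `|(1 + v) `^ s - \sum_(i < n) gbinom s i * v ^+ i| <= C * `|v| ^+ n.
Proof.
elim: n s => [|n IH] s.
  exists (expR `|s|) => [|v hv]; first exact: expR_ge0.
  by rewrite big_ord0 subr0 expr0 mulr1 ger0_norm ?powR_ge0 ?powR_near1_bound.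
have [C C0 hC] := IH (s - 1).
exists (`|s| * C) => [|v hv]; first exact: mulr_ge0.
pose dh x := s * ((1 + x) `^ (s - 1) - \sum_(i < n) gbinom (s - 1) i * x ^+ i).
pose h x := (1 + x) `^ s - \sum_(i < n.+1) gbinom s i * x ^+ i.
apply: (@norm_le_of_deriv h dh _ _ 2^-1) => //.
- move=> x; rewrite ler_norml => /andP[x1 x2].
  have x0 : 0 < 1 + x by lra.
  have dp : is_derive x 1 ((@powR R ^~ s) \o (fun y => 1 + y))
      (s * (1 + x) `^ (s - 1) * 1).
    apply: is_derive1_comp; first exact: is_derive1_powR.
    by rewrite -[X in is_derive _ _ _ X]add0r; apply: is_deriveD.
  have ds : is_derive x 1 (\sum_(i < n.+1) (gbinom s i \*: (@id R) ^+ i))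
      (\sum_(i < n.+1) gbinom s i *: ((i%:R * x ^+ i.-1) *: 1)).
    by apply: is_derive_sum => i; apply: is_deriveZ; apply: is_deriveX.
  have := is_deriveB dp ds.
  set D := (X in is_derive _ _ _ X) => hD.
  have -> : dh x = D.
    rewrite /D /dh mulr1 big_ord_recl/= mul0r scale0r scaler0 add0r mulrBr.
    congr (_ - _); rewrite mulr_sumr; apply: eq_bigr => i _.
    by rewrite mulrA -gbinomS /bump/= add1n /GRing.scale/= mulr1 mulrA.
  suff -> : h = ((@powR R ^~ s) \o (fun y => 1 + y)) -
      \sum_(i < n.+1) (gbinom s i \*: (@id R) ^+ i) by [].
  apply/funext => y; congr (_ - _).
  by rewrite fct_sumE; apply: eq_bigr => i _; rewrite exprfctE.
- rewrite /h big_ord_recl/= addr0 powR1 gbinom0 expr0 mulr1 big1 ?addr0 ?subrr//.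
  by move=> i _; rewrite expr0n/= mulr0.
- move=> x hx; rewrite /dh normrM -mulrA ler_wpM2l//; exact: hC.
- exact: mulr_ge0.
Qed.

End RealPowers.

(** * The speed of the limiting flow *)

Section Speed.
Context {R : realType} (p : R) (p_ge2 : 2 <= p).
Implicit Types u v : R.

Let pred_neq0 : p - 1 != 0.
Proof. by have p2 := p_ge2; rewrite gt_eqF//; lra. Qed.

Definition conj_exp (p : R) : R := p / (p - 1).

(** Since [(p - 1) * conj_exp p = p], this is [p - 1] times the height of the
    graph of the power [conj_exp p] at [1 + v] above its tangent at [1]. *)
Definition speed (p v : R) : R :=
  (p - 1) * ((1 + v) `^ conj_exp p - 1) - p * v.

Definition speed_slope (p v : R) : R := p * ((1 + v) `^ (p - 1)^-1 - 1).

Let q := conj_exp p.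

Lemma conj_exp_sub1 : q - 1 = (p - 1)^-1.
Proof. by rewrite /q /conj_exp; field. Qed.

Lemma pred_conj_exp : (p - 1) * q = p.
Proof. by rewrite /q /conj_exp; field. Qed.

Lemma conj_exp_bounds : 1 < q <= 2.
Proof.
have p2 := p_ge2.
have p1 : 0 < p - 1 by lra.
by rewrite /q /conj_exp ltr_pdivlMr// ler_pdivrMr//; lra.
Qed.

Lemma inv_pred_bounds : 0 < (p - 1)^-1 <= 1.
Proof. by have := conj_exp_bounds; rewrite -conj_exp_sub1; lra. Qed.

Lemma speed0 : speed p 0 = 0.
Proof. by rewrite /speed addr0 powR1 subrr !mulr0 subr0. Qed.

Lemma speed_ge_tangent u v : -1 <= u -> -1 <= v ->
  speed p v + speed_slope p v * (u - v) <= speed p u.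
Proof.
have p2 := p_ge2.
move=> u1 v1.
have u0 : 0 <= 1 + u by lra.
have v0 : 0 <= 1 + v by lra.
have q1 : 1 <= q by have := conj_exp_bounds; lra.
have := powR_ge_tangent q1 u0 v0.
rewrite conj_exp_sub1 /speed /speed_slope => h.
have p1 : 0 <= p - 1 by lra.
have := ler_wpM2l p1 h; rewrite -/q.
set a := _ `^ q; set b := _ `^ q; set c := _ `^ _ => {}h.
have : (p - 1) * q * (c * (u - v)) = p * (c * (u - v)).
  by rewrite pred_conj_exp.
by move: q h => q' h; lra.
Qed.

Lemma speed_slope_le v : 0 <= v -> speed_slope p v <= p * v.
Proof.
have p2 := p_ge2.
move=> v0; rewrite /speed_slope ler_wpM2l//; first by lra.
have v1 : 0 <= 1 + v by lra.
have s1 := inv_pred_bounds.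
apply: le_trans (_ : (p - 1)^-1 * v <= _).
  by have := bernoulli_le s1 v1; lra.
by rewrite ler_piMl//; lra.
Qed.

Lemma speed_slope_le0 v : -1 <= v <= 0 -> speed_slope p v <= 0.
Proof.
have p2 := p_ge2.
move=> /andP[v1 v0]; rewrite /speed_slope mulr_ge0_le0//; first by lra.
have v2 : 0 <= 1 + v by lra.
have s1 := inv_pred_bounds.
have := bernoulli_le s1 v2.
have : (p - 1)^-1 * (1 + v - 1) <= 0 by rewrite mulr_ge0_le0//; lra.
by lra.
Qed.

Lemma speed_slope_norm v : -1 <= v -> `|speed_slope p v| <= p * `|v|.
Proof.
have p2 := p_ge2.
move=> v1; have [v0|v0] := leP 0 v.
  rewrite (ger0_norm v0) ger0_norm ?speed_slope_le//.
  rewrite mulr_ge0//; first by lra.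
  rewrite subr_ge0 -{1}(powRr0 (1 + v)) ler_powR//; first by lra.
  by have := inv_pred_bounds; lra.
rewrite (ltr0_norm v0) ler0_norm ?speed_slope_le0//; last by lra.
rewrite /speed_slope -mulrN ler_wpM2l//; first by lra.
suff : 1 + v <= (1 + v) `^ (p - 1)^-1 by lra.
have := v1; rewrite -subr_ge0 opprK addrC le_eqVlt => /predU1P[<-|v2].
  by rewrite powR_ge0.
by rewrite ger1_powR//; have := inv_pred_bounds; lra.
Qed.

Lemma speed_le v : -1 <= v -> speed p v <= p * v ^+ 2.
Proof.
have p2 := p_ge2.
move=> v1; have n1 : (-1 : R) <= 0 by lra.
have := speed_ge_tangent n1 v1.
rewrite speed0 sub0r mulrN subr_le0 => /le_trans; apply.
rewrite -real_normK ?num_real// expr2 mulrA (le_trans (ler_norm _))//.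
by rewrite normrM ler_wpM2r// speed_slope_norm.
Qed.

Lemma speed_ge0 v : -1 <= v -> 0 <= speed p v.
Proof.
move=> v1; have n1 : (-1 : R) <= 0 by lra.
have := speed_ge_tangent v1 n1.
by rewrite speed0 /speed_slope addr0 powR1 subrr mulr0 mul0r addr0.
Qed.

(** Half of the displacement is enough for the slope to reach a definite
    fraction of its linear size, and the graph stays above the tangent taken
    there. *)
Lemma speed_ge v : `|v| <= 1 -> v ^+ 2 / 8 <= speed p v.
Proof.
have p2 := p_ge2.
rewrite ler_norml => /andP[v1 v2].
have w1 : -1 <= v / 2 by lra.
have := speed_ge_tangent v1 w1.
have := speed_ge_tangent (u := 0) (v := v / 2).
rewrite speed0.
have s1 := inv_pred_bounds.
have ps : p * (p - 1)^-1 = q by [].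
have q1 := conj_exp_bounds.
have w0 : 0 < 1 + v / 2 by lra.
have G : (v / 2) ^+ 2 / 2 <= speed_slope p (v / 2) * (v / 2).
  set w := v / 2 in w0 *; rewrite expr2 mulrAC.
  rewrite /speed_slope; set b := _ `^ _.
  have [v0|v0] := leP 0 v.
    have w' : 0 <= w by rewrite /w; lra.
    rewrite ler_wpM2r//.
    have := @bernoulli_neg R (p - 1)^-1 (1 + w)^-1.
    rewrite powRN invr_gt0 w0 => /(_ _ isT)/wrap[|]; first by lra.
    have -> : ((1 + w)^-1 `^ (p - 1)^-1)^-1 = b.
      by rewrite -powRN -[(1 + w)^-1]powR_inv1 ?ltW// -powRrM mulN1r opprK.
    have -> : 1 - (1 + w)^-1 = w / (1 + w) by field; rewrite gt_eqF.
    move=> h; apply: le_trans (_ : p * ((p - 1)^-1 * (w / (1 + w))) <= _).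
      rewrite mulrA ps.
      have e : w / 2 <= w / (1 + w).
        by rewrite ler_wpM2l// lef_pV2 ?posrE//; rewrite /w; lra.
      apply: le_trans e _; rewrite ler_peMl//; last by lra.
      by rewrite divr_ge0// ltW.
    by rewrite ler_wpM2l//; lra.
  have w' : w <= 0 by rewrite /w; lra.
  rewrite ler_wnM2r//.
  have := bernoulli_le s1 (ltW w0); rewrite -/b.
  rewrite (_ : 1 + w - 1 = w); last by ring.
  move=> h.
  apply: le_trans (_ : p * ((p - 1)^-1 * w) <= _).
    by rewrite ler_wpM2l//; lra.
  rewrite mulrA ps; apply: le_trans (_ : 1 * w <= _); last by lra.
  by rewrite ler_wnM2r//; lra.
have e : v - v / 2 = v / 2 by field.
rewrite e => /(_ _ w1)/wrap[|h1 h2]; first by lra.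
have h3 := speed_ge0 w1.
by move: G h2; rewrite exprMn; lra.
Qed.

Definition quad_coef (p : R) : R := conj_exp p / 2.
Definition cub_coef (p : R) : R := conj_exp p * (conj_exp p - 2) / 6.

Lemma speed_taylor : exists2 C, 0 <= C & forall v, `|v| <= 1 ->
  `|speed p v - quad_coef p * v ^+ 2 - cub_coef p * v ^+ 3| <= C * v ^+ 4.
Proof.
have p2 := p_ge2.
have [C C0 hC] := powR_taylor 4 q.
have q1 := conj_exp_bounds.
pose K := p + `|quad_coef p| + `|cub_coef p|.
have K0 : 0 <= K by rewrite /K; have := normr_ge0 (quad_coef p);
  have := normr_ge0 (cub_coef p); lra.
exists ((p - 1) * C + 16 * K) => [|v v1]; first by rewrite addr_ge0 ?mulr_ge0//; lra.
have v4 : `|v| ^+ 4 = v ^+ 4 by rewrite -normrX ger0_norm// exprn_even_ge0.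
rewrite mulrDl; have [v2|v2] := leP `|v| 2^-1.
  apply: le_trans (_ : (p - 1) * C * v ^+ 4 <= _); last first.
    by rewrite lerDl mulr_ge0 ?exprn_even_ge0// mulr_ge0.
  rewrite -v4 -mulrA.
  have -> : speed p v - quad_coef p * v ^+ 2 - cub_coef p * v ^+ 3 =
      (p - 1) * ((1 + v) `^ q - \sum_(i < 4) gbinom q i * v ^+ i).
    rewrite !big_ord_recr big_ord0/= add0r /gbinom !big_ord_recr !big_ord0/=.
    rewrite /speed -/q /quad_coef /cub_coef -/q !factS fact0.
    set a := _ `^ q.
    have -> : q = p / (p - 1) by [].
    by field.
  rewrite normrM (ger0_norm (_ : 0 <= p - 1)); last by lra.
  by rewrite ler_wpM2l ?hC//; lra.
apply: le_trans (_ : 16 * K * v ^+ 4 <= _); last first.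
  by rewrite lerDr mulr_ge0 ?exprn_even_ge0// mulr_ge0//; lra.
apply: le_trans (_ : K <= _); last first.
  rewrite mulrC mulrA ler_peMl// -v4.
  have : (2^-1 : R) ^+ 4 <= `|v| ^+ 4.
    by rewrite lerXn2r ?nnegrE ?invr_ge0// ltW.
  by lra.
have b n : `|v ^+ n| <= 1 by rewrite normrX exprn_ile1.
have b' c n : `|c * v ^+ n| <= `|c| by rewrite normrM ler_piMr.
have sp : `|speed p v| <= p.
  have v1' : -1 <= v by move: v1; rewrite ler_norml => /andP[].
  rewrite ger0_norm ?speed_ge0//.
  apply: le_trans (speed_le v1') _; rewrite ler_piMr//; first by lra.
  by rewrite -real_normK ?num_real// exprn_ile1.
rewrite /K; apply: le_trans (ler_normB _ _) _; rewrite lerD//.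
by apply: le_trans (ler_normB _ _) _; rewrite lerD.
Qed.

End Speed.

(** * Travel time *)

Section TravelTime.
Context {R : realType}.

(** The function [atan x + x^-1] is nonincreasing and tends to [pi / 2]. *)
Lemma atan_ge (x : R) : 0 < x -> pi / 2 - x^-1 <= atan x.
Proof.
move=> x0; rewrite lerBlDr; set c := _ + _.
have mono y : x <= y -> atan y <= c.
  move=> xy; have y0 : 0 < y by exact: lt_le_trans xy.
  pose h (z : R) := atan z + z^-1.
  apply: le_trans (_ : h y <= h x); first by rewrite lerDl invr_ge0 ltW.
  pose dh (z : R) := (1 + z ^+ 2)^-1 - z ^- 2.
  have dv (z : R) : 0 < z -> is_derive z 1 h (dh z).
    move=> z0; apply: is_deriveD.
    by apply: is_derive_eq; [apply: is_deriveV; rewrite gt_eqF|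
      rewrite /GRing.scale/= mulr1].
  have [z /andP[xz _]|z /andP[xz _] e] := @mean_value R h dh x y xy.
    by apply: dv; exact: lt_le_trans xz.
  rewrite -subr_le0 e.
  rewrite mulr_le0_ge0 ?subr_ge0// /dh subr_le0 lef_pV2 ?posrE ?lerDr//.
    by rewrite ltr_pwDl ?sqr_ge0.
  by rewrite exprn_gt0// (lt_le_trans x0).
apply: (cvgr_to_le (cvgy_atan (R := R))).
by near=> y; apply: mono; near: y; apply: nbhs_pinfty_ge; rewrite num_real.
Unshelve. all: by end_near. Qed.

Context {p : R} (p_ge2 : 2 <= p).
Implicit Types w t v y F : R.

Let k := quad_coef p.
Let c := cub_coef p.

Lemma quad_coef_gt0 : 0 < k.
Proof. by have := conj_exp_bounds p_ge2; rewrite /k /quad_coef; lra. Qed.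

Definition travel_time p w v : R :=
  - (atan (v / w) / (quad_coef p * w)) +
  cub_coef p / (2 * quad_coef p ^+ 2) *
    (ln (w ^+ 2 + v ^+ 2) + w ^+ 2 / (w ^+ 2 + v ^+ 2)).

(** The reciprocal of the speed with [quad_coef p * w ^+ 2] added, expanded
    to first order in the cubic term. *)
Definition slowness p w v : R :=
  (quad_coef p * (w ^+ 2 + v ^+ 2))^-1
  - cub_coef p * v ^+ 3 / (quad_coef p * (w ^+ 2 + v ^+ 2)) ^+ 2.

Lemma is_derive_travel_time w v : 0 < w ->
  is_derive v 1 (travel_time p w) (- slowness p w v).
Proof.
move=> w0; have k0 := quad_coef_gt0.
have g0 : 0 < w ^+ 2 + v ^+ 2 by rewrite ltr_pwDl ?sqr_ge0// exprn_gt0.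
pose g y := w ^+ 2 + y ^+ 2.
have dg : is_derive v 1 g (2 * v).
  have h : is_derive v 1 g (0 + (2%:R * v ^+ 1) *: 1).
    exact: is_deriveD (is_derive_cst (w ^+ 2) v 1)
                      (is_deriveX 2 (is_derive_id v 1)).
  by apply: (is_derive_eq h); rewrite add0r expr1 /GRing.scale/= mulr1.
have da : is_derive v 1 (@atan R \o (w^-1 \*: @id R))
    ((1 + (w^-1 * v) ^+ 2)^-1 * w^-1).
  apply: is_derive1_comp.
  have h := is_deriveZ (w^-1) (is_derive_id (v : R) (1 : R)).
  by apply: (is_derive_eq h); rewrite /GRing.scale/= mulr1.
have dl : is_derive v 1 (@ln R \o g) ((g v)^-1 * (2 * v)).
  by apply: is_derive1_comp; exact: is_derive1_ln.
have di : is_derive v 1 (fun y => (g y)^-1) (- (g v) ^- 2 *: (2 * v)).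
  by apply: is_deriveV; rewrite gt_eqF.
have h := is_deriveD (is_deriveZ (- (k * w)^-1) da)
  (is_deriveZ (c / (2 * k ^+ 2)) (is_deriveD dl (is_deriveZ (w ^+ 2) di))).
have -> : travel_time p w = (- (k * w)^-1 \*: (@atan R \o (w^-1 \*: @id R)))
    + (c / (2 * k ^+ 2)
       \*: ((@ln R \o g) + (w ^+ 2 \*: (fun y => (g y)^-1)))).
  apply/funext => y; rewrite /travel_time -/k -/c /g.
  rewrite [LHS]/(_ + _) [RHS]/(_ + _); congr (_ + _).
  by rewrite /= [y / w]mulrC [RHS]mulNr; congr (- _); exact: mulrC.
apply: (is_derive_eq h); rewrite /slowness -/k -/c /GRing.scale/= -/(g v).
have -> : 1 + (w^-1 * v) ^+ 2 = g v / w ^+ 2.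
  by rewrite /g; field; rewrite gt_eqF.
have -> : v ^+ 3 = v * (g v - w ^+ 2) by rewrite /g; ring.
by field; rewrite !gt_eqF.
Qed.

(** The logarithmic part, which carries the cubic term of the speed, is even. *)
Lemma travel_time_sym w v : 0 < w ->
  travel_time p w (- v) - travel_time p w v = 2 * (atan (v / w) / (k * w)).
Proof.
by move=> w0; rewrite /travel_time mulNr atanN sqrrN -/k -/c; lra.
Qed.

(** The cubic term of the speed must be kept: without it the difference of the
    reciprocals is in general of order [1 / v] when [v] is larger than [w], and
    its integral over one side of [0] is unbounded as [w] tends to [0].  What is
    left is bounded because the numerator is [O(v ^+ 4)] times the quadratic
    speed, and [v ^+ 4] is at most a multiple of the product of the true and the
    quadratic speeds. *)
Lemma slowness_approx : exists2 M, 0 <= M & forall w v, 0 < w -> `|v| <= 1 ->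
  `|(k * w ^+ 2 + speed p v)^-1 - slowness p w v| <= M.
Proof.
have k0 := quad_coef_gt0.
have [C C0 hC] := speed_taylor p_ge2.
pose D := C + (c ^+ 2 + `|c| * C) / k.
have D0 : 0 <= D.
  by rewrite addr_ge0// divr_ge0 ?(ltW k0)// addr_ge0 ?sqr_ge0// mulr_ge0.
exists (8 * D / k) => [|w v w0 v1].
  by rewrite divr_ge0 ?(ltW k0)// mulr_ge0.
have w2 : 0 < w ^+ 2 by rewrite exprn_gt0.
have := hC v v1; have := speed_ge p_ge2 v1.
rewrite /slowness -/k -/c.
set s := speed p v; set r := s - _ - _ => hs hr.
set g := k * (w ^+ 2 + v ^+ 2); set f := _ + s.
have v2 : 0 <= v ^+ 2 by rewrite sqr_ge0.
have g0 : 0 < g by rewrite mulr_gt0// ltr_wpDr.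
have kw : 0 < k * w ^+ 2 by rewrite mulr_gt0.
have f0 : 0 < f by rewrite /f; lra.
have ef : f = g + c * v ^+ 3 + r by rewrite /f /g /r; ring.
have -> : f^-1 - (g^-1 - c * v ^+ 3 / g ^+ 2) =
    (- (r * g) + c ^+ 2 * v ^+ 6 + c * v ^+ 3 * r) / (f * g ^+ 2).
  have -> : r = f - g - c * v ^+ 3 by rewrite ef; ring.
  by field; rewrite !gt_eqF.
have fg : 0 < f * g ^+ 2 by rewrite mulr_gt0// exprn_gt0.
rewrite normrM (gtr0_norm (_ : 0 < (f * g ^+ 2)^-1)) ?invr_gt0//.
rewrite ler_pdivrMr//.
have v4 : v ^+ 4 = (v ^+ 2) ^+ 2 by rewrite -exprM.
have vg : v ^+ 2 <= g / k.
  by rewrite /g mulrC mulKf ?gt_eqF// lerDr ltW.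
have gk : 0 <= g / k by rewrite divr_ge0// ltW.
have v41 : 0 <= v ^+ 4 by rewrite v4 sqr_ge0.
apply: le_trans (_ : D * (v ^+ 4 * g) <= _).
  rewrite /D [leRHS]mulrDl; apply: le_trans (ler_normD _ _) _.
  apply: le_trans (lerD (ler_normD _ _) (lexx _)) _.
  rewrite -addrA; apply: lerD.
    by rewrite normrN normrM (gtr0_norm g0) [leRHS]mulrA ler_wpM2r// ltW.
  have -> : (c ^+ 2 + `|c| * C) / k * (v ^+ 4 * g) =
      c ^+ 2 * (v ^+ 4 * (g / k)) + `|c| * (C * v ^+ 4) * (g / k).
    by field; rewrite gt_eqF.
  apply: lerD.
    rewrite ger0_norm; last first.
      by apply: mulr_ge0; [exact: sqr_ge0|exact: exprn_even_ge0].
    rewrite ler_wpM2l ?sqr_ge0//.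
    by rewrite [v ^+ 6](exprD v 4 2) ler_wpM2l.
  rewrite normrM [`|c * _|]normrM -mulrA -[leRHS]mulrA ler_wpM2l// [leLHS]mulrC.
  rewrite ler_pM//; apply: le_trans vg.
  rewrite normrX -[v ^+ 2]real_normK ?num_real//.
  by rewrite [leLHS]exprSr ler_piMr// exprn_ge0.
have -> : 8 * D / k * (f * g ^+ 2) = D * ((8 * f) * (g / k) * g).
  by field; rewrite gt_eqF.
rewrite ler_wpM2l// ler_wpM2r ?(ltW g0)// v4 expr2 ler_pM//.
by rewrite /f; lra.
Qed.

(** The terms in [M] are increments of a linear function of the position: they
    add up to a bounded amount over any number of consecutive steps. *)
Lemma travel_time_bounds : exists2 M, 0 <= M & forall w t y F, 0 < w ->
  -1 <= t -> t <= y -> y <= 1 -> 0 < F ->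
  ((forall x, t <= x <= y -> F <= k * w ^+ 2 + speed p x) ->
    travel_time p w t - travel_time p w y <= (y - t) / F + M * (y - t)) /\
  ((forall x, t <= x <= y -> k * w ^+ 2 + speed p x <= F) ->
    (y - t) / F - M * (y - t) <= travel_time p w t - travel_time p w y).
Proof.
have k0 := quad_coef_gt0.
have [M M0 hM] := slowness_approx; exists M => // w t y F w0 t1 ty y1 F0.
have [x /andP[tx xy] e] := @mean_value R (travel_time p w)
  (fun v => - slowness p w v) t y ty (fun x _ => is_derive_travel_time x w0).
have {e} -> : travel_time p w t - travel_time p w y = slowness p w x * (y - t).
  by rewrite -opprB e mulNr opprK.
have x1 : `|x| <= 1 by rewrite ler_norml; apply/andP; split; lra.
have := hM w x w0 x1; rewrite ler_norml => /andP[h1 h2].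
have yt : 0 <= y - t by lra.
have f0 : 0 < k * w ^+ 2 + speed p x.
  have x1' : -1 <= x by lra.
  by rewrite ltr_wpDr ?speed_ge0// mulr_gt0// exprn_gt0.
split=> [/(_ x)|/(_ x)]; rewrite tx xy => /(_ isT) h.
  rewrite [_ / F]mulrC -mulrDl ler_wpM2r//.
  have : (k * w ^+ 2 + speed p x)^-1 <= F^-1 by rewrite lef_pV2.
  by move: h1 h2; set f := _^-1; lra.
rewrite [_ / F]mulrC -mulrBl ler_wpM2r//.
have : F^-1 <= (k * w ^+ 2 + speed p x)^-1 by rewrite lef_pV2.
by move: h1 h2; set f := (k * _ + _)^-1; lra.
Qed.

Lemma travel_time_total_ge w a : 0 < w -> 0 < a ->
  pi / (k * w) - 2 / (k * a) <= travel_time p w (- a) - travel_time p w a.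
Proof.
move=> w0 a0; have k0 := quad_coef_gt0.
rewrite travel_time_sym// mulrA ler_pdivlMr ?(mulr_gt0 k0 w0)//.
have -> : (pi / (k * w) - 2 / (k * a)) * (k * w) = 2 * (pi / 2 - (a / w)^-1).
  by field; rewrite !gt_eqF.
by rewrite ler_wpM2l// atan_ge// divr_gt0.
Qed.

Lemma travel_time_total_le w a : 0 < w ->
  travel_time p w (- a) - travel_time p w a <= pi / (k * w).
Proof.
move=> w0; have k0 := quad_coef_gt0.
rewrite travel_time_sym// mulrA ler_pM2r ?invr_gt0 ?(mulr_gt0 k0 w0)//.
by have := atan_ltpi2 (a / w); lra.
Qed.

End TravelTime.

(** * From the weighted Hardy inequality to a scalar recursion *)

Section Transfer.
Context {R : realType} {p : R} (p_ge2 : 2 <= p).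
Implicit Types X z A a : R.

(** With [c = 1 + mu * (X - 1) * z], the quotient of
    [(c - 1) * A ^ p + mu * a ^ p] by the [p]-th power of the next mean
    [((X - 1) * A + a) / X] is least for [a = optimal_ratio p z * A], and its
    least value is [mu * transfer p X z]. *)
Definition optimal_ratio p z : R := z `^ (p - 1)^-1.

Definition transfer p X z : R :=
  X * z * ((X - 1 + optimal_ratio p z) / X) `^ (1 - p).

Lemma optimal_ratioM z : 0 <= z ->
  z * optimal_ratio p z = optimal_ratio p z `^ p.
Proof.
have p2 := p_ge2; move=> z0; rewrite /optimal_ratio.
have m0 : (p - 1)^-1 * (p - 1) = 1 by rewrite mulVf// gt_eqF//; lra.
have e : z = (z `^ (p - 1)^-1) `^ (p - 1) by rewrite -powRrM m0 powRr1.
by rewrite {1}e mulrC mulr_powRB1 ?powR_ge0//; lra.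
Qed.

(** Convexity of the power function at the two points [A] and [a / rho], with
    weights proportional to [X - 1] and [rho]; the value of [rho] makes the
    coefficient of the second one equal to [1]. *)
Lemma transfer_le X z A a : 1 < X -> 0 <= z -> 0 <= A -> 0 <= a ->
  transfer p X z * (((X - 1) * A + a) / X) `^ p <=
  (X - 1) * z * A `^ p + a `^ p.
Proof.
have p2 := p_ge2; move=> X1 z0 A0 a0.
have := optimal_ratioM z0; rewrite /transfer; set r := optimal_ratio p z.
have [-> _|zn0 hr] := eqVneq z 0.
  by rewrite !(mulr0, mul0r) add0r powR_ge0.
have r0 : 0 < r by rewrite powR_gt0// lt_neqAle eq_sym zn0.
have Xr : 0 < X - 1 + r by lra.
have Xp : 0 < X by lra.
set s := (X - 1 + r) / X; set B := ((X - 1) * A + a) / X.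
have s0 : 0 < s by rewrite divr_gt0.
have B0 : 0 <= B.
  by rewrite divr_ge0 ?(ltW Xp)// addr_ge0// mulr_ge0//; lra.
pose M := B / s.
have M0 : 0 <= M by rewrite divr_ge0// ltW.
have ar0 : 0 <= a / r by rewrite divr_ge0// ltW.
have p1 : 1 <= p by lra.
have h1 := powR_ge_tangent p1 A0 M0.
have h2 := powR_ge_tangent p1 ar0 M0.
have eM : (X - 1 + r) * M = (X - 1) * A + r * (a / r).
  by rewrite /M /B /s; field; rewrite !gt_eqF.
have -> : X * z * s `^ (1 - p) * B `^ p = (X - 1 + r) * z * M `^ p.
  have -> : B = s * M by rewrite /M; field; rewrite gt_eqF.
  rewrite powRM ?(ltW s0)// mulrA -[X * z * _ * _]mulrA -powRD; last first.
    by apply/implyP => _; rewrite gt_eqF.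
  rewrite subrK powRr1 ?(ltW s0)//.
  by rewrite /s; field; rewrite gt_eqF.
have -> : a `^ p = z * (r * (a / r) `^ p).
  by rewrite mulrA hr -powRM ?(ltW r0)//; congr (_ `^ _); field; rewrite gt_eqF.
suff : (X - 1 + r) * M `^ p <= (X - 1) * A `^ p + r * (a / r) `^ p.
  move=> /(ler_wpM2l z0).
  by set AA := A `^ p; set m := M `^ p; set u := _ `^ p; lra.
move: h1 h2 eM; set D := p * _; set u := a / r; set m := M `^ p => h1 h2 eM.
have X1' : 0 <= X - 1 by lra.
have := ler_wpM2l X1' h1; have := ler_wpM2l (ltW r0) h2.
have : D * ((X - 1 + r) * M) = D * ((X - 1) * A + r * u) by rewrite eM.
by set AA := A `^ p; set uu := u `^ p; lra.
Qed.

Lemma transfer_eq X z A : 1 < X -> 0 <= z -> 0 <= A ->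
  transfer p X z * ((X - 1 + optimal_ratio p z) / X * A) `^ p =
  (X - 1) * z * A `^ p + (optimal_ratio p z * A) `^ p.
Proof.
have p2 := p_ge2; move=> X1 z0 A0.
have := optimal_ratioM z0; rewrite /transfer; set r := optimal_ratio p z => hr.
have r0 : 0 <= r by exact: powR_ge0.
have Xp : 0 < X by lra.
set s := (X - 1 + r) / X.
have s0 : 0 < s by rewrite divr_gt0//; lra.
rewrite (powRM _ (ltW s0) A0) (powRM _ r0 A0) mulrA.
rewrite -[X * z * _ * _]mulrA -powRD; last first.
  by apply/implyP => _; rewrite gt_eqF.
rewrite subrK powRr1 ?(ltW s0)// -hr /s; field; rewrite gt_eqF//.
Qed.

End Transfer.

Section Reduction.
Context {R : realType} {p : R} (p_ge2 : 2 <= p).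
Context {lam : nat -> R} (lam_gt0 : forall k, (1 <= k)%N -> 0 < lam k).
Implicit Types (a z : nat -> R) (mu c : R) (n k K N : nat).

Let sum1S (F : nat -> R) n : (1 <= n)%N ->
  \sum_(1 <= i < n.+1) F i = \sum_(1 <= i < n) F i + F n.
Proof. by move=> n1; rewrite big_nat_recr. Qed.

Definition normalized_sum lam n : R := partial_sum lam n / lam n.

Definition weighted_mean lam a n : R :=
  \sum_(1 <= k < n.+1) lam k * a k / partial_sum lam n.

Let X := normalized_sum lam.

Lemma partial_sumS n : partial_sum lam n.+1 = partial_sum lam n + lam n.+1.
Proof. by rewrite /partial_sum big_nat_recr. Qed.

Lemma partial_sum_ge0 n : 0 <= partial_sum lam n.
Proof.
rewrite /partial_sum big_seq; apply: sumr_ge0 => i.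
by rewrite mem_index_iota => /andP[i1 _]; rewrite ltW ?lam_gt0.
Qed.

Lemma partial_sum_gt0 n : (1 <= n)%N -> 0 < partial_sum lam n.
Proof.
by case: n => // n _; rewrite partial_sumS ltr_wpDl ?partial_sum_ge0 ?lam_gt0.
Qed.

Lemma partial_sum1 : partial_sum lam 1 = lam 1%N.
Proof. by rewrite /partial_sum big_nat1. Qed.

Lemma normalized_sum1 : X 1 = 1.
Proof. by rewrite /X /normalized_sum partial_sum1 divff// gt_eqF ?lam_gt0. Qed.

Lemma normalized_sum_sub1 n : X n.+1 - 1 = partial_sum lam n / lam n.+1.
Proof.
rewrite /X /normalized_sum partial_sumS mulrDl divff ?addrK//.
by rewrite gt_eqF ?lam_gt0.
Qed.

Lemma normalized_sum_gt1 n : (1 <= n)%N -> 1 < X n.+1.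
Proof.
move=> n1; rewrite -subr_gt0 normalized_sum_sub1.
by rewrite divr_gt0 ?partial_sum_gt0 ?lam_gt0.
Qed.

Lemma weighted_mean1 a : weighted_mean lam a 1 = a 1%N.
Proof.
rewrite /weighted_mean big_nat1 partial_sum1 mulrAC divff ?mul1r//.
by rewrite gt_eqF ?lam_gt0.
Qed.

Lemma weighted_meanS a n : (1 <= n)%N -> weighted_mean lam a n.+1 =
  ((X n.+1 - 1) * weighted_mean lam a n + a n.+1) / X n.+1.
Proof.
move=> n1; rewrite normalized_sum_sub1 /X /normalized_sum /weighted_mean.
have L0 := partial_sum_gt0 n1.
have L1 := partial_sum_gt0 (ltn0Sn n).
have l1 := lam_gt0 (ltn0Sn n).
rewrite -!mulr_suml big_nat_recr//=.
by field; rewrite !gt_eqF.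
Qed.

Lemma weighted_mean_ge0 a n :
  (forall k, (1 <= k <= n)%N -> 0 <= a k) -> 0 <= weighted_mean lam a n.
Proof.
move=> a0; rewrite /weighted_mean big_seq; apply: sumr_ge0 => k.
rewrite mem_index_iota ltnS => k1.
rewrite divr_ge0 ?partial_sum_ge0// mulr_ge0 ?a0// ltW// lam_gt0//.
by case/andP: k1.
Qed.

(** By [transfer_le] and induction on [k], the sum of the [mu * a n ^ p] for
    [n <= k] exceeds that of the [A n ^ p] for [n < k] by at least
    [(1 + mu * (X k.+1 - 1) * z k) * A k ^ p]. *)
Lemma hardy_constant_of_subsolution mu z N : 0 < mu -> (1 <= N)%N ->
  (forall k, (1 <= k <= N)%N -> 0 <= z k) ->
  1 + mu * ((X 2 - 1) * z 1%N) <= mu ->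
  (forall k, (1 <= k < N)%N ->
    1 + mu * ((X k.+2 - 1) * z k.+1) <= mu * transfer p (X k.+1) (z k)) ->
  hardy_constants p lam N mu.
Proof.
move=> mu0 N1 z0 hz1 hz a a0.
pose A := weighted_mean lam a.
have A0 k : (k <= N)%N -> 0 <= A k.
  move=> kN; apply: weighted_mean_ge0 => i /andP[i1 ik]; apply: a0.
  by rewrite i1 (leq_trans ik).
have inv k : (1 <= k <= N)%N ->
    (1 + mu * ((X k.+1 - 1) * z k)) * A k `^ p + \sum_(1 <= n < k) A n `^ p
    <= mu * \sum_(1 <= n < k.+1) `|a n| `^ p.
  elim: k => // -[_ _|k IH /andP[_ kN]].
    rewrite big_geq// addr0 big_nat1 /A weighted_mean1.
    by rewrite ger0_norm ?a0// ler_wpM2r// powR_ge0.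
  have := IH (ltnW kN) => {}IH.
  rewrite [in leLHS]sum1S// [in leRHS]sum1S// [in leRHS]mulrDr.
  have ak : 0 <= a k.+2 by rewrite a0.
  have Xk : 1 < X k.+2 by exact: normalized_sum_gt1.
  have Ak : 0 <= A k.+1 by exact: A0 (ltnW kN).
  have zk : 0 <= z k.+1 by apply: z0; exact: ltnW.
  have := transfer_le p_ge2 Xk zk Ak ak.
  rewrite -weighted_meanS// -/(A _) (ger0_norm ak) => h.
  have hk : (1 <= k.+1 < N)%N by [].
  have := ler_wpM2r (powR_ge0 (A k.+2) p) (hz _ hk).
  have := ler_wpM2l (ltW mu0) h.
  move: IH; rewrite !mulrDr !mulrDl !mul1r.
  set S := \sum_(_ <= _ < _) _; set S' := \sum_(_ <= _ < _) _.
  by lra.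
have NN : (1 <= N <= N)%N by rewrite N1 leqnn.
have -> : \sum_(1 <= n < N.+1) `|weighted_mean lam a n| `^ p =
    \sum_(1 <= n < N.+1) A n `^ p.
  by apply: eq_big_nat => n /andP[n1 nN]; rewrite ger0_norm//; exact: A0.
apply: le_trans (inv N NN).
rewrite [leLHS]sum1S// [leLHS]addrC lerD2r mulrDl mul1r lerDl.
rewrite mulr_ge0 ?powR_ge0// mulr_ge0 ?(ltW mu0)// mulr_ge0 ?z0//.
by rewrite subr_ge0 ltW// normalized_sum_gt1.
Qed.

(** The orbit [z_1, z_2, ...] started with [c_1 = mu]; the value at [0] is a
    dummy. *)
Fixpoint riccati p lam mu n : R :=
  match n with
  | 0 => 0
  | n'.+1 => if n' is 0 then (1 - mu^-1) / (normalized_sum lam 2 - 1)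
             else (transfer p (normalized_sum lam n) (riccati p lam mu n')
                   - mu^-1) / (normalized_sum lam n.+1 - 1)
  end.

Lemma riccatiS mu n : (1 <= n)%N ->
  (X n.+2 - 1) * riccati p lam mu n.+1 =
  transfer p (X n.+1) (riccati p lam mu n) - mu^-1.
Proof.
case: n => // n _; rewrite [riccati _ _ _ _]/= -/(riccati p lam mu n.+1) -/X.
rewrite [LHS]mulrC divfK//.
by rewrite gt_eqF// subr_gt0 normalized_sum_gt1.
Qed.

(** The orbit describes the extremal sequence for [mu]; if it stops being
    positive then truncating that sequence there gives a quotient which is at
    least [mu]. *)
Lemma riccati_gt0 mu c N k : 0 < mu -> hardy_constants p lam N c -> c < mu ->
  (1 <= k <= N)%N -> 0 < riccati p lam mu k.
Proof.
move=> mu0 hc cmu /andP[k1 kN]; rewrite ltNge; apply/negP => zk.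
pose z := riccati p lam mu.
have ex : exists n, (1 <= n <= N)%N && (z n <= 0).
  by exists k; rewrite k1 kN.
case: (ex_minnP ex) => K /andP[/andP[K1 KN] zK] minK.
have zpos n : (1 <= n < K)%N -> 0 < z n.
  move=> /andP[n1 nK]; rewrite ltNge; apply/negP => zn.
  have := minK n; rewrite n1 zn (leq_trans (ltnW nK) KN) => /(_ isT).
  by rewrite leqNgt nK.
pose r n := optimal_ratio p (z n).
pose A := fix A (n : nat) : R := match n with
  | 0 => 1
  | n'.+1 => if n' is 0 then 1 else (X n - 1 + r n') / X n * A n'
  end.
have AS n : (1 <= n)%N -> A n.+1 = (X n.+1 - 1 + r n) / X n.+1 * A n.
  by case: n.
have A0 n : 0 <= A n.
  elim: n => [|[|n] IH]; rewrite ?ler01// AS// mulr_ge0// divr_ge0//.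
    rewrite addr_ge0 ?powR_ge0// subr_ge0 ltW// normalized_sum_gt1//.
  by rewrite ltW// (lt_trans ltr01)// normalized_sum_gt1.
pose a (n : nat) : R := match n with
  | 0 => 0
  | n'.+1 => if n' is 0 then 1 else if (n' < K)%N then r n' * A n' else 0
  end.
have aS n : (1 <= n)%N -> a n.+1 = if (n < K)%N then r n * A n else 0.
  by case: n.
have a0 n : 0 <= a n.
  case: n => [|[|n]]; rewrite /= ?lexx ?ler01//.
  case: ifP => // _; apply: mulr_ge0; first exact: powR_ge0.
  exact: (A0 n.+1).
have mA n : (1 <= n <= K)%N -> weighted_mean lam a n = A n.
  elim: n => // -[_ _|n IH /andP[_ nK]]; first by rewrite weighted_mean1.
  rewrite weighted_meanS// IH ?(ltnW nK)// aS// nK [RHS]AS//.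
  by rewrite -mulrDl [RHS]mulrAC.
have inv n : (1 <= n <= K)%N ->
    (1 + mu * ((X n.+1 - 1) * z n)) * A n `^ p + \sum_(1 <= i < n) A i `^ p
    = mu * \sum_(1 <= i < n.+1) `|a i| `^ p.
  elim: n => // -[_ _|n IH /andP[_ nK]].
    rewrite big_geq// addr0 big_nat1 normr1 powR1 !mulr1 /z/=.
    rewrite -/X [_ * (_ / _)]mulrC divfK; last first.
      by rewrite gt_eqF// subr_gt0 normalized_sum_gt1.
    by rewrite mulrBr mulr1 divff ?gt_eqF// addrC subrK.
  have := IH (ltnW nK) => {}IH.
  rewrite [in RHS]sum1S// mulrDr -IH sum1S//.
  rewrite (ger0_norm (a0 _)) aS// nK.
  have Xn : 1 < X n.+2 by exact: normalized_sum_gt1.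
  have := transfer_eq p_ge2 Xn (ltW (zpos n.+1 nK)) (A0 n.+1).
  rewrite -/(r n.+1) -AS// => e.
  rewrite riccatiS// mulrBr divff ?gt_eqF// [1 + _]addrC subrK.
  by rewrite -mulrA e; ring.
have KK : (1 <= K <= K)%N by rewrite K1 leqnn.
have := inv K KK.
pose S := \sum_(1 <= i < K.+1) `|a i| `^ p.
have S1 : 1 <= S.
  rewrite /S big_nat_recl//= normr1 powR1 lerDl.
  by apply: sumr_ge0 => i _; exact: powR_ge0.
have SN : \sum_(1 <= i < N.+1) `|a i| `^ p = S.
  rewrite (big_cat_nat _ (n := K.+1))//= -[RHS]addr0; congr (_ + _).
  rewrite big_nat_cond big1// => -[//|i] /andP[/andP[+ _] _].
  rewrite ltnS => Ki; rewrite aS ?(leq_trans K1)// ltnNge Ki/= normr0 powR0//.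
  by apply/eqP; have p2 := p_ge2; lra.
have := hc a (fun n _ => a0 n); rewrite SN.
have -> : \sum_(1 <= n < N.+1) `|weighted_mean lam a n| `^ p =
    \sum_(1 <= n < K.+1) A n `^ p +
    \sum_(K.+1 <= n < N.+1) `|weighted_mean lam a n| `^ p.
  rewrite (big_cat_nat _ (n := K.+1))//=; congr (_ + _).
  by apply: eq_big_nat => n hn; rewrite mA// ger0_norm.
rewrite [in X in X -> _]sum1S//; set T := \sum_(1 <= _ < K) _.
set T' := \sum_(K.+1 <= _ < _) _.
have T0 : 0 <= T' by apply: sumr_ge0 => n _; exact: powR_ge0.
rewrite -/S => h1 h2.
have XK : 0 < X K.+1 - 1 by rewrite subr_gt0 normalized_sum_gt1.
have : mu * ((X K.+1 - 1) * z K) * A K `^ p <= 0.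
  rewrite mulr_le0_ge0 ?powR_ge0// mulr_ge0_le0 ?(ltW mu0)//.
  by rewrite mulr_ge0_le0// ltW.
have : 0 < (mu - c) * S by rewrite mulr_gt0//; lra.
by move: h2; rewrite mulrDl mul1r; lra.
Qed.

End Reduction.

(** * Euler steps along the flow *)

Section Euler.
Context {R : realType} {p : R} (p_ge2 : 2 <= p).
Implicit Types (w h u v d : R) (n k : nat).

Let k0 := quad_coef_gt0 p_ge2.

(** By convexity the speed varies during an Euler step by a relative amount of
    the order of the step length, so the travel time spent on the step is the
    step length up to its square. *)
Lemma euler_survival : exists2 M, 0 <= M &
  forall (w d : R) (h y : nat -> R) (n : nat), 0 < w -> 0 < d <= 1 ->
  (forall k, 0 <= h k /\ 2 * p * d * h k <= 1) -> y 0%N = d ->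
  (forall k, y k.+1 = y k - h k * (quad_coef p * w ^+ 2 + speed p (y k))) ->
  \sum_(k < n) h k * (1 + 2 * p * h k) + M <
    travel_time p w (- d) - travel_time p w d ->
  forall k, (k <= n)%N -> - d <= y k <= d.
Proof.
have p2 := p_ge2.
have [M M0 hM] := travel_time_bounds p_ge2; exists (2 * M) => [|w d h y n w0].
  by rewrite mulr_ge0.
move=> /andP[d0 d1] hh y0 yS hn k kn.
pose T := travel_time p w; pose f v := quad_coef p * w ^+ 2 + speed p v.
have hp j : 0 <= h j * (1 + 2 * p * h j).
  have [h0 _] := hh j; rewrite mulr_ge0// addr_ge0// mulr_ge0//.
  by rewrite mulr_ge0//; lra.
suff : - d <= y k <= d /\
    T (y k) - T d <= \sum_(j < k) h j * (1 + 2 * p * h j) + M * (d - y k).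
  by case.
elim: k kn => [_|k IH kn].
  by rewrite y0 big_ord0 !subrr mulr0 addr0 lexx andbT; split=> //; lra.
have [/andP[yd1 yd2] yT] := IH (ltnW kn).
have y1 : -1 <= y k by lra.
have [hk0 hk1] := hh k.
have f0 : 0 < f (y k).
  by rewrite ltr_pwDl ?speed_ge0// mulr_gt0 ?k0// exprn_gt0.
have yk : y k.+1 <= y k by rewrite yS gerBl mulr_ge0// ltW.
pose F := f (y k) * (1 - p * d * h k).
have e0 : 0 < 1 - p * d * h k by lra.
have F0 : 0 < F by rewrite mulr_gt0.
have step t : - d <= t -> y k.+1 <= t -> t <= y k ->
    T t - T d <= \sum_(j < k.+1) h j * (1 + 2 * p * h j) + M * (d - t).
  move=> td yt ty.
  have t1 : -1 <= t by lra.
  have yle1 : y k <= 1 by lra.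
  have [a _] := hM w t (y k) F w0 t1 ty yle1 F0.
  have {}a : T t - T (y k) <= (y k - t) / F + M * (y k - t).
    apply: a => x /andP[tx xy].
    have x1 : -1 <= x by lra.
    have := speed_ge_tangent p_ge2 x1 y1.
    have sl : speed_slope p (y k) <= p * d.
      apply: le_trans (ler_norm _) _.
      rewrite (le_trans (speed_slope_norm p_ge2 y1))// ler_wpM2l//.
        by lra.
      by rewrite ler_norml; apply/andP; split; lra.
    have yx : 0 <= y k - x by lra.
    have := ler_wpM2r yx sl.
    have yx' : y k - x <= h k * f (y k) by move: (yS k); rewrite -/(f _); lra.
    have pd : 0 <= p * d by rewrite mulr_ge0//; lra.
    have := ler_wpM2l pd yx'.
    by rewrite /F /f; set s := speed _ _; set s' := speed _ _; lra.
  rewrite big_ord_recr/=.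
  suff : (y k - t) / F <= h k * (1 + 2 * p * h k) by move: a yT; lra.
  rewrite ler_pdivrMr//.
  apply: le_trans (_ : h k * f (y k) <= _).
    by move: (yS k); rewrite -/(f _); lra.
  have -> : h k * (1 + 2 * p * h k) * F =
    h k * f (y k) * ((1 + 2 * p * h k) * (1 - p * d * h k)) by rewrite /F; ring.
  rewrite ler_peMr ?mulr_ge0 ?(ltW f0)//.
  have ph : 0 <= p * h k by rewrite mulr_ge0//; lra.
  have : p * d * h k <= p * h k by rewrite mulrAC ler_piMr.
  have : 0 <= (p * h k) * (1 - 2 * p * d * h k) by rewrite mulr_ge0//; lra.
  by lra.
(* a first exit through - d would have taken the whole travel time *)
have [yk1|yk1] := leP (- d) (y k.+1).
  by split; [apply/andP; split; lra|exact: step].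
exfalso; move: hn; apply/negP; rewrite -leNgt.
have := step (- d) (lexx _) (ltW yk1) yd1.
rewrite -/(T _) -/(T _) => /le_trans; apply; apply: lerD; last first.
  by rewrite opprK mulrDr; have := ler_wpM2l M0 d1; lra.
rewrite -[in leRHS](subnKC kn) big_split_ord/= lerDl.
by apply: sumr_ge0.
Qed.

(** An orbit that stays in the interval cannot have used more than the total
    travel time. *)
Lemma euler_extinction : exists2 M, 0 <= M &
  forall (w : R) (h u : nat -> R) (n : nat), 0 < w -> (forall k, 0 <= h k) ->
  (forall k, (k <= n)%N -> -1 <= u k <= 1) ->
  (forall k, (k < n)%N ->
    u k.+1 <= u k - h k * (quad_coef p * w ^+ 2 + speed p (u k))) ->
  \sum_(k < n) h k * (1 - p * h k) <= pi / (quad_coef p * w) + M.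
Proof.
have p2 := p_ge2.
have [M M0 hM] := travel_time_bounds p_ge2; exists (2 * M) => [|w h u n w0].
  by rewrite mulr_ge0.
move=> h0 u1 uS.
pose S v := travel_time p w v - M * v.
pose f v := quad_coef p * w ^+ 2 + speed p v.
have down t y F : -1 <= t -> t <= y -> y <= 1 -> 0 < F ->
    (forall x, t <= x <= y -> f x <= F) -> (y - t) / F <= S t - S y.
  move=> t1 ty y1 F0 hF; have [_ /(_ hF)] := hM w t y F w0 t1 ty y1 F0.
  by rewrite /S; lra.
have e0 : 0 < quad_coef p * w ^+ 2 by rewrite mulr_gt0 ?k0// exprn_gt0.
have anti t y : -1 <= t -> t <= y -> y <= 1 -> S y <= S t.
  move=> t1 ty y1; have F0 : 0 < quad_coef p * w ^+ 2 + p by lra.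
  rewrite -subr_ge0; apply: le_trans (down t y _ t1 ty y1 F0 _).
    by rewrite divr_ge0 ?(ltW F0)//; lra.
  move=> x /andP[tx xy]; rewrite lerD2l.
  have x1 : -1 <= x by lra.
  apply: le_trans (speed_le p_ge2 x1) _; rewrite ler_piMr//; first by lra.
  rewrite -real_normK ?num_real// exprn_ile1// ler_norml.
  by apply/andP; split; lra.
suff main k : (k <= n)%N ->
    \sum_(j < k) h j * (1 - p * h j) <= S (u k) - S (u 0%N).
  apply: le_trans (main n (leqnn _)) _.
  have /andP[a1 a2] := u1 n (leqnn _); have /andP[b1 b2] := u1 0%N (leq0n _).
  have := @anti (-1) (u n) (lexx _) a1 a2.
  have := @anti (u 0%N) 1 b1 b2 (lexx _).
  have := travel_time_total_le p_ge2 1 w0.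
  by rewrite /S; lra.
elim: k => [_|k IH kn]; first by rewrite big_ord0 subrr.
rewrite big_ord_recr/=; have := IH (ltnW kn).
have /andP[a1 a2] := u1 k (ltnW kn).
have /andP[b1 b2] := u1 k.+1 kn.
have := uS k kn; rewrite -/(f _); set t := _ - _ => tu.
have f0 : 0 < f (u k) by rewrite ltr_pwDl ?speed_ge0.
have tk : t <= u k by rewrite /t gerBl mulr_ge0// ltW.
have t1 : -1 <= t by lra.
have ph : 0 <= p * h k by rewrite mulr_ge0//; lra.
pose F := f (u k) * (1 + p * h k).
have F0 : 0 < F by rewrite mulr_gt0//; lra.
have D : (u k - t) / F <= S t - S (u k).
  apply: down => // x /andP[tx xu].
  have x1 : -1 <= x by lra.
  have := speed_ge_tangent p_ge2 a1 x1.
  have sl : - p <= speed_slope p x.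
    apply: le_trans (_ : - `|speed_slope p x| <= _); last first.
      by rewrite lerNl -normrN ler_norm.
    rewrite lerN2 (le_trans (speed_slope_norm p_ge2 x1))// ler_piMr//.
      by lra.
    by rewrite ler_norml; apply/andP; split; lra.
  have xu' : 0 <= u k - x by lra.
  have := ler_wpM2r xu' sl.
  have pp : 0 <= p by lra.
  have xt : u k - x <= h k * f (u k) by rewrite /t in tx; lra.
  have := ler_wpM2l pp xt.
  by rewrite /F /f; set s := speed _ _; set s' := speed _ _; lra.
have tle1 : t <= 1 by lra.
have := anti (u k.+1) t b1 tu tle1.
suff : h k * (1 - p * h k) <= (u k - t) / F by lra.
rewrite ler_pdivlMr// /t opprB subrKC.
have -> : h k * (1 - p * h k) * F = h k * f (u k) * (1 - (p * h k) ^+ 2).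
  by rewrite /F; ring.
rewrite ler_piMr ?mulr_ge0 ?(ltW f0)//.
by have := sqr_ge0 (p * h k); lra.
Qed.

End Euler.

(** * Harmonic sums *)

Section Sums.
Context {R : realType}.
Implicit Types n k : nat.

Lemma harmonic_sum_le n : (1 <= n)%N ->
  \sum_(k < n) (k.+1%:R)^-1 <= 1 + ln n%:R :> R.
Proof.
elim: n => // -[_ _|n IH _]; first by rewrite big_ord1 invr1 ln1 addr0.
rewrite big_ord_recr/=; apply: le_trans (lerD (IH isT) (lexx _)) _.
rewrite -addrA lerD2l.
set m : R := n.+1%:R; have -> : n.+2%:R = m + 1 :> R by rewrite natr1.
have m0 : 0 < m by rewrite ltr0n.
have m1 : 0 < m + 1 by lra.
have : ln (m / (m + 1)) <= - (m + 1)^-1.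
  have -> : m / (m + 1) = 1 + - (m + 1)^-1 by field; rewrite gt_eqF.
  by rewrite le_ln1Dx// ltrN2 invf_lt1//; lra.
by rewrite ln_div ?posrE//; lra.
Qed.

Lemma sum_inv_sqr_le n : \sum_(k < n) (k.+1%:R ^+ 2)^-1 <= 2 :> R.
Proof.
suff h : forall m, \sum_(k < m.+1) (k.+1%:R ^+ 2)^-1 <= 2 - (m.+1%:R)^-1 :> R.
  case: n => [|n]; first by rewrite big_ord0.
  by apply: le_trans (h n) _; rewrite gerBl invr_ge0.
elim=> [|m IH]; first by rewrite big_ord1 expr1n invr1; lra.
rewrite big_ord_recr/=; apply: le_trans (lerD IH (lexx _)) _.
set x : R := m.+1%:R; have -> : m.+2%:R = x + 1 :> R by rewrite natr1.
have x0 : 0 < x by rewrite ltr0n.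
have x1 : 0 < x + 1 by lra.
rewrite -subr_ge0.
have -> : 2 - (x + 1)^-1 - (2 - x^-1 + ((x + 1) ^+ 2)^-1) =
   (x * (x + 1) ^+ 2)^-1 by field; rewrite !gt_eqF.
by rewrite invr_ge0 mulr_ge0 ?sqr_ge0// ltW.
Qed.

Lemma sum_inv_affine_ge (L : R) n k : 0 < L ->
  L^-1 * (ln (1 + L * (k + n)%:R) - ln (1 + L * k%:R))
  <= \sum_(j < n) (1 + L * (k + j)%:R)^-1.
Proof.
move=> L0; elim: n => [|n IH]; first by rewrite addn0 big_ord0 subrr mulr0.
rewrite big_ord_recr/=; apply: le_trans (lerD IH (lexx _)).
rewrite addnS -(natr1 (k + n)) [L * (_ + 1)]mulrDr mulr1 addrA.
set a := 1 + L * (k + n)%:R; set b := ln (1 + L * k%:R).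
have a0 : 0 < a by rewrite ltr_wpDr// mulr_ge0// ltW.
rewrite -subr_ge0.
have -> : L^-1 * (ln a - b) + a^-1 - L^-1 * (ln (a + L) - b) =
    L^-1 * (L / a - (ln (a + L) - ln a)) by field; rewrite !gt_eqF.
rewrite mulr_ge0 ?invr_ge0 ?(ltW L0)// subr_ge0.
have aL : 0 < a + L by lra.
rewrite -ln_div ?posrE//.
have -> : (a + L) / a = 1 + L / a by field; rewrite gt_eqF.
have La : 0 < L / a by rewrite divr_gt0.
by rewrite le_ln1Dx//; lra.
Qed.

End Sums.

(** * Upper estimate for the best constant *)

Section Asymptotics.
Context {R : realType} {p : R} (p_ge2 : 2 <= p).
Context {lam : nat -> R} (lam_gt0 : forall k, (1 <= k)%N -> 0 < lam k).
Context {L d : R} (L_bounds : 0 < L <= 1) (d_gt0 : 0 < d).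

Let X := normalized_sum lam.
Let k0 := quad_coef_gt0 p_ge2.

(** The limit of the ratio of the sequence to its mean for the powers that are
    extremal in the limit of large [N]. *)
Definition fixed_ratio p L : R := 1 - L / p.

Let W := fixed_ratio p L.

Context (gap_lb : forall k, (1 <= k)%N -> d <= X k.+1 - X k).
Context (gap_ub : forall k, (1 <= k)%N -> X k.+1 - X k <= L).

Lemma fixed_ratio_bounds : 2^-1 <= W < 1.
Proof.
have p2 := p_ge2; have /andP[L0 L1] := L_bounds.
have : 0 < L / p by rewrite divr_gt0//; lra.
have : L / p <= 2^-1 by rewrite ler_pdivrMr//; lra.
by rewrite /W /fixed_ratio; lra.
Qed.

Let W0 : 0 < W.
Proof. by have := fixed_ratio_bounds; lra. Qed.

Lemma fixed_ratioE : p * W = p - L.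
Proof.
have p2 := p_ge2.
by rewrite /W /fixed_ratio; field; rewrite gt_eqF//; lra.
Qed.

Lemma normalized_sum_ge n : 1 + d * n%:R <= X n.+1.
Proof.
elim: n => [|n IH]; first by rewrite mulr0 addr0 /X normalized_sum1.
by have := gap_lb (ltn0Sn n); rewrite -(natr1 n); lra.
Qed.

Lemma normalized_sum_le n : X n.+1 <= 1 + L * n%:R.
Proof.
elim: n => [|n IH]; first by rewrite mulr0 addr0 /X normalized_sum1.
by have := gap_ub (ltn0Sn n); rewrite -(natr1 n); lra.
Qed.

(** [W `^ (p - 1)] is the double root of the limiting equation, at the critical
    value [W `^ p] of [mu^-1]; around it the drift falls short of [W `^ p] by a
    multiple of the speed. *)
Lemma driftE v : -1 <= v -> let z := W `^ (p - 1) * (1 + v) in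
  z * ((p - 1) * (1 - optimal_ratio p z) + 1 - L) = W `^ p * (1 - speed p v).
Proof.
have p2 := p_ge2; move=> v1 z.
have v0 : 0 <= 1 + v by lra.
have z0 : 0 <= z by rewrite mulr_ge0 ?powR_ge0.
have zr : z * optimal_ratio p z = W `^ p * (1 + v) `^ conj_exp p.
  rewrite optimal_ratioM// /optimal_ratio -powRrM [_^-1 * p]mulrC -/(conj_exp p).
  by rewrite powRM ?powR_ge0// -powRrM pred_conj_exp.
have eW : W `^ p = W * W `^ (p - 1).
  by rewrite mulr_powRB1 ?(ltW W0)//; lra.
have -> : z * ((p - 1) * (1 - optimal_ratio p z) + 1 - L) =
    z * (p - L) - (p - 1) * (z * optimal_ratio p z) by ring.
by rewrite zr -fixed_ratioE /z eW /speed; ring.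
Qed.

Lemma transfer_ge Y z : 1 < Y -> 0 <= z ->
  z * (Y + (p - 1) * (1 - optimal_ratio p z)) <= transfer p Y z.
Proof.
have p2 := p_ge2; move=> Y1 z0; rewrite /transfer.
set r := optimal_ratio p z; have r0 : 0 <= r by exact: powR_ge0.
have Y0 : 0 < Y by lra.
have x0 : 0 < (Y - 1 + r) / Y by rewrite divr_gt0//; lra.
have p1 : 0 <= p - 1 by lra.
have := bernoulli_neg p1 x0; rewrite opprB => h.
have -> : z * (Y + (p - 1) * (1 - r)) =
    Y * z * (1 + (p - 1) * (1 - (Y - 1 + r) / Y)) by field; rewrite gt_eqF.
by rewrite ler_wpM2l// mulr_ge0// ltW.
Qed.

(** The reverse inequality needs [Y] large compared with the optimal ratio, to
    stay inside the range of the binomial expansion. *)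
Lemma transfer_le_taylor (Z : R) : exists2 C, 0 <= C &
  forall Y z, 1 < Y -> 0 <= z <= Z -> 2 * (1 + optimal_ratio p Z) <= Y ->
  transfer p Y z <= z * (Y + (p - 1) * (1 - optimal_ratio p z)) + C / Y.
Proof.
have p2 := p_ge2.
have [C C0 hC] := powR_taylor 2 (1 - p).
set r := optimal_ratio p Z; have r0 : 0 <= r by exact: powR_ge0.
exists (`|Z| * C * (1 + r) ^+ 2) => [|Y z Y1 /andP[z0 zZ] hY].
  by apply: mulr_ge0; rewrite ?sqr_ge0 ?mulr_ge0.
have Y0 : 0 < Y by lra.
have s0 : 0 <= (p - 1)^-1 by rewrite invr_ge0; lra.
have Z0 : 0 <= Z by lra.
have := ge0_ler_powR s0 z0 Z0 zZ; rewrite -/(optimal_ratio p z).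
rewrite -/(optimal_ratio p Z) -/r /transfer; set s := optimal_ratio p z => sr.
have s1 : 0 <= s by exact: powR_ge0.
pose t := (s - 1) / Y.
have tY : `|t| <= (1 + r) / Y.
  rewrite normrM (gtr0_norm (_ : 0 < Y^-1)) ?invr_gt0// ler_wpM2r ?invr_ge0 ?(ltW Y0)//.
  by rewrite ler_norml; apply/andP; split; lra.
have t2 : `|t| <= 2^-1.
  by apply: le_trans tY _; rewrite ler_pdivrMr//; lra.
have := hC t t2.
rewrite !big_ord_recr big_ord0/= add0r gbinom0.
have := gbinomS (1 - p) 0; rewrite gbinom0 !mulr1 => ->.
have -> : 1 + t = (Y - 1 + s) / Y by rewrite /t; field; rewrite gt_eqF.
rewrite expr1 => /ler_normlW h.
have h' : ((Y - 1 + s) / Y) `^ (1 - p) <= 1 + (1 - p) * t + C * `|t| ^+ 2 by lra.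
have Yz : 0 <= Y * z by rewrite mulr_ge0// ltW.
apply: le_trans (ler_wpM2l Yz h') _.
have -> : Y * z * (1 + (1 - p) * t + C * `|t| ^+ 2) =
    z * (Y + (p - 1) * (1 - s)) + Y * z * (C * `|t| ^+ 2).
  by rewrite /t; field; rewrite gt_eqF.
rewrite lerD2l.
apply: le_trans (_ : Y * Z * (C * ((1 + r) / Y) ^+ 2) <= _); last first.
  rewrite (ger0_norm Z0) le_eqVlt; apply/orP; left; apply/eqP.
  by field; rewrite gt_eqF.
apply: ler_pM => //; first by rewrite mulr_ge0// sqr_ge0.
- by rewrite ler_wpM2l// ltW.
- by rewrite ler_wpM2l// lerXn2r ?nnegrE// divr_ge0 ?(ltW Y0)//; lra.
Qed.

(** [pi / (quad_coef p * w)] is the time needed to pass the double root, and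
    about [W / L * ln N] is available before [N]; this is the [w] for which the
    two agree up to the constant [C]. *)
Definition width p L C N : R :=
  pi / (quad_coef p * (fixed_ratio p L / L * ln N%:R + C)).

Definition critical_constant p L w : R :=
  (fixed_ratio p L `^ p * (1 + quad_coef p * w ^+ 2))^-1.

Lemma critical_constant_gt0 w : 0 < critical_constant p L w.
Proof.
rewrite invr_gt0 mulr_gt0 ?powR_gt0// ltr_wpDr//.
by rewrite mulr_ge0 ?(ltW k0)// sqr_ge0.
Qed.

Lemma passage_timeK (E : R) : 0 < E ->
  pi / (quad_coef p * (pi / (quad_coef p * E))) = E.
Proof.
move=> E0; have kappa := k0; have := pi_gt0 R.
by move: (pi : R) => x x0; field; rewrite !gt_eqF.
Qed.

Let step_length k := W / (X k.+2 + L - 1).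

Lemma step_length_bounds k : 0 <= step_length k <= (d * k.+1%:R)^-1 /\
  L * step_length k <= 1.
Proof.
have Wb := fixed_ratio_bounds; have /andP[L0 L1] := L_bounds.
have dk : 0 < d * k.+1%:R :> R by rewrite mulr_gt0 ?ltr0n.
have Yd : L + d * k.+1%:R <= X k.+2 + L - 1 by have := normalized_sum_ge k.+1; lra.
rewrite /step_length; set Y := _ - 1 in Yd *.
have Y0 : 0 < Y by lra.
have LW : L * W <= L by rewrite ler_piMr ?(ltW L0)//; lra.
split; last by rewrite mulrA ler_pdivrMr//; lra.
rewrite divr_ge0 ?(ltW W0) ?(ltW Y0)//=.
rewrite ler_pdivrMr// mulrC ler_pdivlMr//.
have : W * (d * k.+1%:R) <= d * k.+1%:R by rewrite ler_piMl ?(ltW dk)//; lra.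
by lra.
Qed.

(** The linear lower bound for [X] makes [step_length k] at most
    [W / (L * k.+1)] up to a term of order [k.+1 ^- 2]. *)
Lemma step_sum_le (Cx : R) :
  (forall k, (1 <= k)%N -> L * k%:R - Cx <= X k.+1) ->
  exists2 B, 0 <= B & forall N, (1 <= N)%N ->
    \sum_(k < N) step_length k * (1 + 2 * p * step_length k) <=
    W / L * ln N%:R + B.
Proof.
move=> hX; have p2 := p_ge2; have /andP[L0 L1] := L_bounds.
have Wb := fixed_ratio_bounds.
have D0 : 0 < d * L by rewrite mulr_gt0.
have d2 : 0 < d ^+ 2 by rewrite exprn_gt0.
have C1 : 0 <= `|Cx| + 1 by rewrite addr_ge0.
pose B := (`|Cx| + 1) / (d * L) + 2 * p / d ^+ 2.
have B0 : 0 <= B.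
  by apply: addr_ge0; apply: divr_ge0; rewrite ?(ltW D0) ?(ltW d2)//; lra.
have WL : 0 <= W / L by rewrite divr_ge0 ?(ltW W0) ?(ltW L0).
have hB k : step_length k * (1 + 2 * p * step_length k) <=
    W / L * (k.+1%:R)^-1 + B * (k.+1%:R ^+ 2)^-1.
  have [/andP[h0 hd] _] := step_length_bounds k.
  set m : R := k.+1%:R in hd *; have m0 : 0 < m by rewrite ltr0n.
  have dm : 0 < d * m by rewrite mulr_gt0.
  have h2 : step_length k ^+ 2 <= (d ^+ 2)^-1 * (m ^+ 2)^-1.
    by rewrite -invfM -exprMn -exprVn lerXn2r ?nnegrE ?invr_ge0 ?(ltW dm).
  have h1 : step_length k <=
      W / L * m^-1 + (`|Cx| + 1) / (d * L) * (m ^+ 2)^-1.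
    have Ym : L * m - (`|Cx| + 1) <= X k.+2 + L - 1.
      by have := hX k.+1 isT; rewrite -/m; have := ler_norm Cx; lra.
    have Ydm : d * m <= X k.+2 + L - 1.
      by have := normalized_sum_ge k.+1; rewrite -/m; lra.
    rewrite /step_length; set Y := _ - 1 in Ym Ydm *.
    have Y0 : 0 < Y by lra.
    have -> : W / Y = W / L * m^-1 + W * ((L * m - Y) / (Y * L * m)).
      by field; rewrite !gt_eqF.
    rewrite lerD2l.
    have -> : (`|Cx| + 1) / (d * L) * (m ^+ 2)^-1 =
        (`|Cx| + 1) / ((d * m) * L * m) by field; rewrite !gt_eqF.
    have D1 : 0 < Y * L * m by rewrite !mulr_gt0.
    have D2 : 0 < d * m * L * m by rewrite !mulr_gt0.
    apply: le_trans (_ : W * ((`|Cx| + 1) / (Y * L * m)) <= _).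
      by rewrite ler_wpM2l ?(ltW W0)// ler_wpM2r ?invr_ge0 ?(ltW D1)//; lra.
    apply: le_trans (_ : (`|Cx| + 1) / (Y * L * m) <= _).
      by rewrite ler_piMl ?divr_ge0 ?(ltW D1)//; lra.
    rewrite ler_wpM2l// lef_pV2 ?posrE//.
    by rewrite ler_wpM2r ?(ltW m0)// ler_wpM2r ?(ltW L0).
  have -> : step_length k * (1 + 2 * p * step_length k) =
    step_length k + 2 * p * step_length k ^+ 2 by ring.
  have -> : B * (m ^+ 2)^-1 = (`|Cx| + 1) / (d * L) * (m ^+ 2)^-1 +
      2 * p * ((d ^+ 2)^-1 * (m ^+ 2)^-1) by rewrite /B; ring.
  have pp : 0 <= 2 * p by lra.
  by rewrite addrA; apply: lerD => //; exact: ler_wpM2l.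
exists (W / L + B * 2) => [|N N1]; first by apply: addr_ge0 => //; exact: mulr_ge0.
apply: le_trans; first by apply: ler_sum => k _; exact: hB.
rewrite big_split/= -!mulr_sumr addrA lerD// ?ler_wpM2l ?sum_inv_sqr_le//.
rewrite -[X in _ <= _ + X]mulr1 -mulrDr addrC ler_wpM2l//.
exact: harmonic_sum_le.
Qed.

(** At the limiting constant the orbit starts strictly to the right of the
    double root: the margin is the value of the speed at [W `^ (p - 1) - 1]. *)
Lemma initial_margin : exists2 r, 0 < r & forall dl eps,
  0 <= dl <= r -> 0 <= eps <= r ->
  W `^ p * (1 + eps) + L * (W `^ (p - 1) * (1 + dl)) <= 1.
Proof.
have p2 := p_ge2; have /andP[L0 L1] := L_bounds; have Wb := fixed_ratio_bounds.
have Wp1 : W `^ (p - 1) < 1.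
  have := @gt0_ltr_powR R (p - 1) _ W 1; rewrite powR1; apply; rewrite ?nnegrE//; lra.
have Wp0 : 0 < W `^ (p - 1) by rewrite powR_gt0.
have eW : W `^ p = W * W `^ (p - 1).
  by rewrite mulr_powRB1 ?(ltW W0)//; lra.
pose s0 := speed p (W `^ (p - 1) - 1).
have s0E : 1 - W `^ p - L * W `^ (p - 1) = s0.
  rewrite /s0 /speed (_ : 1 + (W `^ (p - 1) - 1) = W `^ (p - 1)); last by ring.
  rewrite -powRrM pred_conj_exp// eW.
  have -> : L = p - p * W by rewrite fixed_ratioE; ring.
  by ring.
have s0_gt0 : 0 < s0.
  have h : `|W `^ (p - 1) - 1| <= 1 by rewrite ler_norml; apply/andP; split; lra.
  apply: lt_le_trans (speed_ge p_ge2 h).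
  by rewrite divr_gt0// exprn_even_gt0//=; apply/eqP; lra.
exists (s0 / 2) => [|dl eps /andP[dl0 dl1] /andP[eps0 eps1]]; first by rewrite divr_gt0.
have a1 : W `^ p * eps <= eps.
  by rewrite ler_piMl// eW mulr_ile1 ?(ltW W0) ?(ltW Wp0) ?(ltW Wp1)//; lra.
have a2 : L * W `^ (p - 1) * dl <= dl.
  by rewrite ler_piMl// mulr_ile1 ?(ltW L0) ?(ltW Wp0) ?(ltW Wp1).
by move: s0E a1 a2; set a := W `^ p; set b := W `^ (p - 1); lra.
Qed.

(** An Euler scheme that stays to the right of [-1] is a subsolution at every
    index: the two inequalities used, a Bernoulli inequality and [gap_ub], both
    go in the right direction. *)
Lemma euler_subsolution (w dl : R) (y : nat -> R) (N : nat) : 0 < w ->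
  (1 <= N)%N -> -1 <= dl -> y 0%N = dl ->
  (forall k, y k.+1 = y k -
    step_length k * (quad_coef p * w ^+ 2 + speed p (y k))) ->
  (forall k, (k <= N)%N -> -1 <= y k) ->
  W `^ p * (1 + quad_coef p * w ^+ 2) + L * (W `^ (p - 1) * (1 + dl)) <= 1 ->
  hardy_constants p lam N (critical_constant p L w).
Proof.
move=> w0 N1 dl1 y0 yS y1 h1; have p2 := p_ge2.
have /andP[L0 L1] := L_bounds.
have Wp0 : 0 < W `^ (p - 1) by rewrite powR_gt0.
have eW : W `^ p = W * W `^ (p - 1).
  by rewrite mulr_powRB1 ?(ltW W0)//; lra.
set eps := quad_coef p * w ^+ 2 in yS h1.
pose mu := critical_constant p L w.
have mu0 : 0 < mu by exact: critical_constant_gt0.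
have muV : mu^-1 = W `^ p * (1 + eps) by rewrite /mu /critical_constant invrK.
pose z k := W `^ (p - 1) * (1 + y k.-1).
have z0 k : (1 <= k <= N)%N -> 0 <= z k.
  move=> /andP[k_1 kN]; rewrite mulr_ge0 ?(ltW Wp0)//.
  have : (k.-1 <= N)%N by rewrite (leq_trans (leq_pred k)).
  by move=> /y1; lra.
have mu_le a b : mu^-1 + a <= b -> 1 + mu * a <= mu * b.
  move=> /(ler_wpM2l (ltW mu0)).
  by rewrite mulrDr divff// gt_eqF.
apply: (@hardy_constant_of_subsolution _ _ p_ge2 _ lam_gt0 _ z) => //.
  rewrite -[leRHS]mulr1; apply: mu_le; rewrite muV /z/= y0.
  apply: le_trans h1; rewrite lerD2l ler_wpM2r//.
    by rewrite mulr_ge0 ?(ltW Wp0)//; lra.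
  by have := normalized_sum_le 1; rewrite mulr1 -/X; lra.
move=> k /andP[k_1 kN]; apply: mu_le.
have zk0 : 0 <= z k by rewrite z0// k_1 ltnW.
have zk1 : 0 <= z k.+1 by rewrite z0.
apply: le_trans (transfer_ge (normalized_sum_gt1 lam_gt0 k_1) zk0).
case: k k_1 kN zk0 zk1 => // k _ kN zk0 zk1.
have v1 := y1 k (ltnW (ltnW kN)).
have := driftE v1; rewrite /= -/(z k.+1) => dr.
have Y0 : 0 < X k.+2 + L - 1.
  have : 0 <= d * k.+1%:R by rewrite mulr_ge0// ltW.
  by have := normalized_sum_ge k.+1; lra.
pose Y := X k.+2 + L - 1.
apply: le_trans (_ : mu^-1 + Y * z k.+2 <= _).
  rewrite lerD2l ler_wpM2r// /Y.
  by have := gap_ub (ltn0Sn k.+1); rewrite -/X; lra.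
have -> : Y * z k.+2 = Y * z k.+1 - W `^ p * (eps + speed p (y k)).
  by rewrite /z/= yS /step_length -/Y eW; field; rewrite gt_eqF.
rewrite muV -/X.
have -> : z k.+1 * (X k.+2 + (p - 1) * (1 - optimal_ratio p (z k.+1))) =
  Y * z k.+1 + z k.+1 * ((p - 1) * (1 - optimal_ratio p (z k.+1)) + 1 - L).
  by rewrite /Y; ring.
by rewrite dr; lra.
Qed.

(** If [w] is such that the total travel time exceeds the sum of the steps,
    then the Euler scheme survives up to [N]; its starting point [dl] must be
    small enough for [initial_margin] and for the step condition of
    [euler_survival]. *)
Lemma hardy_constant_le (Cx : R) :
  (forall k, (1 <= k)%N -> L * k%:R - Cx <= X k.+1) ->
  exists2 C, 0 < C & forall N, (1 <= N)%N ->
    hardy_constants p lam N (critical_constant p L (width p L C N)).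
Proof.
move=> hX; have p2 := p_ge2; have /andP[L0 L1] := L_bounds.
have [M M0 hM] := euler_survival p_ge2.
have [B B0 hB] := step_sum_le hX.
have [r r0 hr] := initial_margin.
have kappa := k0.
pose dl := Num.min r (L / (2 * p)).
have dl0 : 0 < dl by rewrite lt_min r0 divr_gt0//; lra.
have dlr : dl <= r by rewrite ge_min lexx.
have dlL : 2 * p * dl <= L.
  have : dl <= L / (2 * p) by rewrite ge_min lexx orbT.
  by rewrite ler_pdivlMr; lra.
have dl1 : dl <= 1.
  have : 0 <= (2 * p - 1) * dl by rewrite mulr_ge0 ?(ltW dl0)//; lra.
  by move: dlL; lra.
pose D := 2 / (quad_coef p * dl).
pose Q := pi ^+ 2 / (quad_coef p * r).
have D0 : 0 < D by rewrite divr_gt0// (mulr_gt0 kappa dl0).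
have Q0 : 0 < Q by rewrite divr_gt0 ?(mulr_gt0 kappa r0)// exprn_gt0// pi_gt0.
exists (1 + B + M + D + Q) => [|N N1]; first by move: B0 M0 D0 Q0; lra.
have lN : 0 <= ln (N%:R : R) by rewrite ln_ge0// ler1n.
pose E := W / L * ln N%:R + (1 + B + M + D + Q).
have WL : 0 <= W / L * ln N%:R by rewrite mulr_ge0// divr_ge0 ?(ltW W0) ?(ltW L0).
have [E0 E1 EQ] : [/\ 0 < E, 1 <= E & Q <= E].
  by move: B0 M0 D0 Q0 WL; rewrite /E; split; lra.
set w := width _ _ _ _; have wE : w = pi / (quad_coef p * E) by [].
have w0 : 0 < w by rewrite wE divr_gt0 ?pi_gt0// (mulr_gt0 kappa E0).
have eps0 : 0 <= quad_coef p * w ^+ 2 by rewrite mulr_ge0 ?(ltW kappa)// sqr_ge0.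
(* the summand Q of the constant makes the detuning at most r for every N *)
have epsr : quad_coef p * w ^+ 2 <= r.
  have -> : quad_coef p * w ^+ 2 = r * (Q / E ^+ 2).
    rewrite wE /Q; move: (pi : R) => x.
    by field; rewrite !gt_eqF.
  rewrite ler_piMr ?(ltW r0)// ler_pdivrMr ?exprn_gt0// mul1r.
  by apply: le_trans EQ _; rewrite expr2 ler_peMr ?(ltW E0).
pose y := fix y (n : nat) : R := match n with
  | 0 => dl
  | n'.+1 => y n' - step_length n' * (quad_coef p * w ^+ 2 + speed p (y n'))
  end.
apply: (@euler_subsolution w dl y N) => //; first by move: dl0; lra.
- move=> k kN; suff /andP[h _] : - dl <= y k <= dl by move: h dl1; lra.
  apply: (hM w dl step_length y N w0 _ _ (erefl _)) kN => //; first by rewrite dl0.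
    move=> j; have [/andP[h0 _] hL] := step_length_bounds j; split=> //.
    by apply: le_trans hL; exact: ler_wpM2r.
  apply: lt_le_trans (travel_time_total_ge p_ge2 w0 dl0).
  rewrite wE passage_timeK// -/D.
  apply: le_lt_trans (lerD (hB N N1) (lexx M)) _.
  by rewrite /E; move: Q0; lra.
- by apply: hr; rewrite ?eps0// dlr ltW.
Qed.

End Asymptotics.

(** * Lower estimate for the best constant *)

Section Extinction.
Context {R : realType} {p : R} (p_ge2 : 2 <= p).
Context {lam : nat -> R} (lam_gt0 : forall k, (1 <= k)%N -> 0 < lam k).
Context {L d : R} (L_bounds : 0 < L <= 1) (d_gt0 : 0 < d).

Let X := normalized_sum lam.
Let k0 := quad_coef_gt0 p_ge2.
Let W := fixed_ratio p L.
Let W0 : 0 < W.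
Proof. by have := fixed_ratio_bounds p_ge2 L_bounds; rewrite -/W; lra. Qed.

Context (gap_lb : forall k, (1 <= k)%N -> d <= X k.+1 - X k).
Context (gap_ub : forall k, (1 <= k)%N -> X k.+1 - X k <= L).

Let Xge n : 1 + d * n%:R <= X n.+1 := normalized_sum_ge lam_gt0 gap_lb n.
Let Xle n : X n.+1 <= 1 + L * n%:R := normalized_sum_le lam_gt0 gap_ub n.

Lemma normalized_sum_large (r : R) :
  exists K : nat, forall k, (K <= k)%N -> r <= X k.+1.
Proof.
exists (Num.bound (`|r| / d)) => k Kk.
have rd : 0 <= `|r| / d by rewrite divr_ge0// ltW.
have := archi_boundP rd; rewrite ltr_pdivrMr// => rK.
have : (Num.bound (`|r| / d))%:R <= k%:R :> R by rewrite ler_nat.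
rewrite -(ler_pM2r d_gt0) => h.
by have := ler_norm r; have := Xge k; lra.
Qed.

(** Testing the convexity inequality on a constant sequence bounds every orbit
    independently of [mu]. *)
Lemma riccati_le mu N : 0 < mu ->
  (forall k, (1 <= k <= N)%N -> 0 < riccati p lam mu k) ->
  forall k, (1 <= k <= N)%N -> riccati p lam mu k <= d^-1.
Proof.
move=> mu0 z0.
have muV : 0 <= mu^-1 by rewrite invr_ge0 ltW.
have h k : (1 <= k <= N)%N -> (X k.+1 - 1) * riccati p lam mu k <= k%:R.
  elim: k => // -[_ _|k IH /andP[_ kN]].
    rewrite [riccati _ _ _ _]/= -/X mulrC divfK; first by lra.
    by rewrite gt_eqF// subr_gt0; exact: normalized_sum_gt1.
  rewrite riccatiS//.
  have Xk : 1 < X k.+2 by exact: normalized_sum_gt1.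
  have zk : 0 < riccati p lam mu k.+1 by rewrite z0//= ltnW.
  have := transfer_le p_ge2 Xk (ltW zk) ler01 ler01.
  rewrite mulr1 subrK divff ?gt_eqF ?(lt_trans ltr01)// powR1 !mulr1 => h1.
  have := IH (ltnW kN); rewrite -(natr1 k.+1) -/X; lra.
move=> k kN; have := h k kN; have := z0 k kN.
move: kN => /andP[k1 _]; set z := riccati _ _ _ _ => zk hk.
rewrite -[leRHS]mul1r ler_pdivlMr//.
have kp : 0 < k%:R :> R by rewrite ltr0n.
rewrite -(ler_pM2l kp) mulr1; apply: le_trans hk.
have dX : d * k%:R <= X k.+1 - 1 by have := Xge k; lra.
by have := ler_wpM2r (ltW zk) dX; lra.
Qed.

(** The sum of the reciprocals of [X] diverges, so a constant speed brings any
    sequence starting below [V] down to [b] within the same number of steps. *)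
Lemma descent (a V b : R) (K : nat) : 0 < a -> exists2 K' : nat, (K <= K')%N &
  forall v : nat -> R, v K <= V ->
  (forall k, (K <= k < K')%N -> b < v k -> v k.+1 <= v k - a / X k.+1) ->
  exists2 k, (K <= k <= K')%N & v k <= b.
Proof.
move=> a0; have /andP[L0 L1] := L_bounds.
pose r : R := expR (L / a * `|V - b| + ln (1 + L * K%:R)).
have rL : 0 <= r / L by rewrite divr_ge0 ?expR_ge0 ?ltW.
exists (K + Num.bound (r / L))%N => [|v vK vS]; first exact: leq_addr.
set n := Num.bound _ in vS *.
apply: contrapT => no.
have vb k : (K <= k <= K + n)%N -> b < v k.
  by move=> hk; rewrite ltNge; apply/negP => vk; apply: no; exists k.
have main j : (j <= n)%N ->
    v (K + j)%N <= V - a * \sum_(i < j) (1 + L * (K + i)%:R)^-1.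
  elim: j => [|j IH jn]; first by rewrite addn0 big_ord0 mulr0 subr0.
  have Kj : (K <= K + j < K + n)%N by rewrite leq_addr ltn_add2l.
  have vj : b < v (K + j)%N by apply: vb; rewrite leq_addr leq_add2l ltnW.
  rewrite addnS big_ord_recr/= mulrDr.
  have := vS _ Kj vj; have := IH (ltnW jn).
  suff : a * (1 + L * (K + j)%:R)^-1 <= a / X (K + j).+1 by lra.
  have Xp : 0 < X (K + j).+1.
    have dk : 0 <= d * (K + j)%:R by rewrite mulr_ge0// ltW.
    by have := Xge (K + j); lra.
  by rewrite ler_pM2l// lef_pV2 ?posrE ?Xle// (lt_le_trans Xp)// Xle.
have := main n (leqnn _).
have := sum_inv_affine_ge n K L0.
have bn : b < v (K + n)%N by apply: vb; rewrite leq_addr leqnn.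
set S := \sum_(_ < _) _; set lK := ln (1 + L * K%:R) => S1 vn.
have : L / a * `|V - b| <= ln (1 + L * (K + n)%:R) - lK.
  rewrite -lerBDr opprK.
  rewrite -[leLHS]expRK ler_ln ?posrE ?expR_gt0//.
    have := archi_boundP rL; rewrite -/n ltr_pdivrMr// => rn.
    have : L * n%:R <= L * (K + n)%:R by rewrite ler_pM2l// ler_nat leq_addl.
    by rewrite -/r; move: rn; rewrite mulrC; lra.
  by rewrite ltr_wpDr// mulr_ge0// ltW.
move=> h.
have iL : 0 <= L^-1 by rewrite invr_ge0 ltW.
have := ler_wpM2l iL h.
have -> : L^-1 * (L / a * `|V - b|) = `|V - b| / a by field; rewrite !gt_eqF.
move=> /le_trans/(_ S1); rewrite ler_pdivrMr// => h2.
by have := ler_norm (V - b); lra.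
Qed.

Let v mu k : R := riccati p lam mu k / W `^ (p - 1) - 1.

(** The recursion is an Euler step up to an error of second order, which
    comes from the quadratic term of the binomial expansion and from the
    deviation of [X k.+1 - X k] from [L]. *)
Lemma riccati_step (Cg : R) :
  (forall k, (1 <= k)%N -> L - Cg / k%:R <= X k.+1 - X k) ->
  exists2 C, 0 <= C & exists2 K, (1 <= K)%N & forall w N, 0 < w ->
  let mu := critical_constant p L w in
  (forall k, (1 <= k <= N)%N -> 0 < riccati p lam mu k) ->
  forall k, (K <= k < N)%N ->
  v mu k.+1 <= v mu k
    - W / X k.+1 * (quad_coef p * w ^+ 2 + speed p (v mu k)) + C / X k.+1 ^+ 2.
Proof.
move=> gapO; have p2 := p_ge2; have /andP[L0 L1] := L_bounds.
have [C1 C10 hC1] := transfer_le_taylor p_ge2 d^-1.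
have [K hK] := normalized_sum_large (2 + 2 * (1 + optimal_ratio p d^-1)).
have Wp0 : 0 < W `^ (p - 1) by rewrite powR_gt0.
have eW : W `^ p = W * W `^ (p - 1).
  by rewrite mulr_powRB1 ?(ltW W0)//; lra.
pose C3 := C1 + 2 * `|Cg| / d.
have dV : 0 < d^-1 by rewrite invr_gt0.
have C30 : 0 <= C3 by rewrite addr_ge0// divr_ge0 ?mulr_ge0// ltW.
exists (2 * C3 / W `^ (p - 1)); first by rewrite divr_ge0 ?mulr_ge0// ltW.
exists K.+1 => // w N w0 mu z0 k /andP[Kk kN].
have k1 : (1 <= k)%N by exact: leq_trans Kk.
have := hK k (ltnW Kk); set Y := X k.+1; set ro := optimal_ratio p d^-1 => Yl.
have ro0 : 0 <= ro by exact: powR_ge0.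
have eps0 : 0 < quad_coef p * w ^+ 2 by rewrite mulr_gt0 ?k0 ?exprn_gt0.
set eps := _ * w ^+ 2 in eps0 *.
have muV : mu^-1 = W `^ p * (1 + eps) by rewrite /mu /critical_constant invrK.
have muV0 : 0 < mu^-1 by rewrite muV mulr_gt0 ?powR_gt0//; lra.
have mu0 : 0 < mu by rewrite -invr_gt0.
set z := riccati p lam mu.
have zk : 0 < z k by rewrite z0// k1 ltnW.
have zk' : 0 < z k.+1 by rewrite z0.
have zkd : z k <= d^-1 by apply: (riccati_le mu0 z0); rewrite k1 ltnW.
have zkd' : z k.+1 <= d^-1 by exact: (riccati_le mu0 z0).
have Y1 : 1 < Y by lra.
have Y0 : 0 < Y by lra.
have zz : 0 <= z k <= d^-1 by rewrite (ltW zk).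
have Yl' : 2 * (1 + ro) <= Y by lra.
have hT := hC1 Y (z k) Y1 zz Yl'.
have vE : W `^ (p - 1) * (1 + v mu k) = z k.
  by rewrite /v -/z; field; rewrite gt_eqF.
have v1 : -1 <= v mu k.
  have : 0 <= z k / W `^ (p - 1) by rewrite divr_ge0 ?(ltW zk) ?(ltW Wp0).
  by rewrite /v -/z; lra.
have := driftE p_ge2 L_bounds v1; rewrite -/W /= vE => dr.
have rec : (X k.+2 - 1) * z k.+1 = transfer p Y (z k) - mu^-1.
  exact: (riccatiS (p := p) lam_gt0 mu k1).
have gap : Y + L - 1 - 2 * `|Cg| / Y <= X k.+2 - 1.
  have kp : 0 < k.+1%:R :> R by rewrite ltr0n.
  have := gapO k.+1 isT; rewrite -/Y.
  have Yk : Y <= k.+1%:R.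
    have kk : 0 <= k%:R :> R by [].
    by have := Xle k; have := ler_wpM2r kk L1; rewrite -(natr1 k) -/Y; lra.
  have : Cg / k.+1%:R <= `|Cg| / Y.
    apply: le_trans (_ : `|Cg| / k.+1%:R <= _).
      by rewrite ler_wpM2r ?invr_ge0 ?ler_norm.
    by rewrite ler_wpM2l// lef_pV2 ?posrE.
  have : 0 <= `|Cg| / Y by rewrite divr_ge0// ltW.
  rewrite -[2 * _ / Y]mulrA; set gY := `|Cg| / Y; set gk := Cg / _.
  by lra.
have gap' := ler_wpM2r (ltW zk') gap.
have f0 : 0 <= eps + speed p (v mu k) by have := speed_ge0 p_ge2 v1; lra.
set f := eps + _ in f0 *.
have main : (z k.+1 - z k) * (Y + L - 1) <= - (W `^ p * f) + C3 / Y.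
  have e1 : z k * (Y + (p - 1) * (1 - optimal_ratio p (z k))) =
      z k * (Y + L - 1) +
      z k * ((p - 1) * (1 - optimal_ratio p (z k)) + 1 - L) by ring.
  have e2 : `|Cg| / Y * z k.+1 <= `|Cg| / Y * d^-1.
    by rewrite ler_wpM2l// divr_ge0// ltW.
  have e3 : C3 / Y = C1 / Y + 2 * (`|Cg| / Y * d^-1) by rewrite /C3; ring.
  move: hT gap' rec; rewrite e1 dr muV e3 /f.
  set T := transfer _ _ _; set s := speed _ _.
  set gY := `|Cg| / Y in e2 *.
  have -> : 2 * `|Cg| / Y = 2 * gY by rewrite /gY mulrA.
  by lra.
have YL : Y / 2 <= Y + L - 1 by lra.
have YL0 : 0 < Y + L - 1 by lra.
have main2 : z k.+1 - z k <= - (W `^ p * f / Y) + 2 * C3 / Y ^+ 2.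
  have : z k.+1 - z k <= (- (W `^ p * f) + C3 / Y) / (Y + L - 1).
    by rewrite ler_pdivlMr.
  move=> /le_trans; apply; rewrite mulrDl mulNr lerD//.
    rewrite lerN2 ler_wpM2l ?mulr_ge0 ?powR_ge0// lef_pV2 ?posrE//; lra.
  have -> : 2 * C3 / Y ^+ 2 = C3 / Y / (Y / 2) by field; rewrite gt_eqF.
  have CY : 0 <= C3 / Y by rewrite divr_ge0 ?(ltW Y0).
  rewrite ler_wpM2l//. rewrite lef_pV2 ?posrE//; lra.
have Wi : 0 <= (W `^ (p - 1))^-1 by rewrite invr_ge0 ltW.
have := ler_wpM2l Wi main2.
have -> : (W `^ (p - 1))^-1 * (- (W `^ p * f / Y) + 2 * C3 / Y ^+ 2) =
    - (W / Y * f) + 2 * C3 / W `^ (p - 1) / Y ^+ 2.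
  by rewrite eW; field; rewrite !gt_eqF.
rewrite /v -/z mulrBr mulrC [_^-1 * z k]mulrC; lra.
Qed.

(** The errors of order [X k.+1 ^- 2] have no sign, but since [X] grows at
    least linearly they are dominated by the decrease of a multiple of
    [(X k.+1)^-1]; adding that to the position leaves a clean Euler inequality
    as long as the position is small. *)
Lemma riccati_shifted_step (Cg : R) :
  (forall k, (1 <= k)%N -> L - Cg / k%:R <= X k.+1 - X k) ->
  exists2 C, 0 <= C & exists2 K, (1 <= K)%N & forall w N, 0 < w ->
  let mu := critical_constant p L w in
  let u k := v mu k + C / X k.+1 in
  (forall k, (1 <= k <= N)%N -> 0 < riccati p lam mu k) ->
  forall k, (K <= k < N)%N -> u k <= d / (4 * p) ->
  u k.+1 <= u k - W / X k.+1 * (quad_coef p * w ^+ 2 + speed p (u k)).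
Proof.
move=> gapO; have p2 := p_ge2; have dd := d_gt0; have /andP[L0 L1] := L_bounds.
have [C4 C40 [K K1 hK]] := riccati_step gapO.
exists (4 * C4 / d); first by rewrite divr_ge0 ?mulr_ge0// ltW.
exists K => // w N w0 mu u z0 k /andP[Kk kN]; rewrite /u.
have Kk' : (K <= k < N)%N by rewrite Kk.
have := hK w N w0 z0 k Kk'; rewrite -/mu.
have k1 : (1 <= k)%N by exact: leq_trans Kk.
have dk : 0 <= d * k%:R by rewrite mulr_ge0// ltW.
have Xk : 1 <= X k.+1 by have := Xge k; lra.
have gap1 := gap_lb (ltn0Sn k); have gap2 := gap_ub (ltn0Sn k).
set Y := X k.+1 in Xk gap1 gap2 *; set Y' := X k.+2 in gap1 gap2 *.
set a := v mu k; set C := 4 * C4 / d; set e := _ * w ^+ 2 => hv ub.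
have C0 : 0 <= C by rewrite divr_ge0 ?mulr_ge0// ltW.
have Y0 : 0 < Y by lra.
have Y'0 : 0 < Y' by lra.
have zk : 0 < riccati p lam mu k by rewrite z0// k1 ltnW.
have a1 : -1 <= a.
  have : 0 <= riccati p lam mu k / W `^ (p - 1).
    by rewrite divr_ge0 ?powR_ge0// ltW.
  by rewrite /a /v; lra.
have CY : 0 <= C / Y by rewrite divr_ge0// ltW.
set b := a + C / Y in ub *.
have b1 : -1 <= b by rewrite /b; lra.
have dp : 0 <= d / 4 by lra.
have slope : speed_slope p b <= d / 4.
  have [b0|b0] := leP 0 b; last first.
    by apply: le_trans (speed_slope_le0 p_ge2 _) dp; rewrite b1 ltW.
  apply: le_trans (speed_slope_le p_ge2 b0) _.
  have pp : 0 <= p by lra.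
  apply: le_trans (ler_wpM2l pp ub) _.
  have -> : p * (d / (4 * p)) = d / 4 by field; rewrite gt_eqF//; lra.
  exact: lexx.
have tang : speed p b - d / 4 * (C / Y) <= speed p a.
  have := speed_ge_tangent p_ge2 a1 b1; have := ler_wpM2r CY slope.
  by rewrite /b; lra.
have WY : 0 <= W / Y by rewrite divr_ge0// ltW.
have := ler_wpM2l WY tang.
have -> : W / Y * (speed p b - d / 4 * (C / Y)) =
    W / Y * speed p b - W * (C4 / Y ^+ 2).
  by rewrite /C; field; rewrite !gt_eqF.
have CY2 : 0 <= C4 / Y ^+ 2 by rewrite divr_ge0// sqr_ge0.
have W1 : W <= 1 by have := fixed_ratio_bounds p_ge2 L_bounds; rewrite -/W; lra.
have := ler_piMl CY2 W1.
have inv : C / Y' <= C / Y - 2 * (C4 / Y ^+ 2).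
  rewrite -subr_ge0.
  have -> : C / Y - 2 * (C4 / Y ^+ 2) - C / Y' =
      2 * C4 * (2 * (Y' - Y) * Y - d * Y') / (d * Y ^+ 2 * Y').
    by rewrite /C; field; rewrite !gt_eqF.
  apply: divr_ge0.
    apply: mulr_ge0; first by lra.
    have h1 := ler_wpM2r (ltW Y0) gap1.
    have h2 : d * Y' <= d * (2 * Y) by rewrite ler_wpM2l ?(ltW d_gt0)//; lra.
    by lra.
  by apply: mulr_ge0; [apply: mulr_ge0; [exact: ltW|exact: sqr_ge0]|exact: ltW].
rewrite /b; move: hv inv.
set gg := C4 / Y ^+ 2; set WYY := W / Y; set CYY := C / Y; set CYY' := C / Y'.
by set s := speed p a; set s' := speed p _; lra.
Qed.

(** Uniformly in [w], because [riccati_le] bounds the starting point and the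
    speed of the flow is at least its value at [b] as long as [b] is not
    reached. *)
Lemma riccati_reaches (Cg b : R) (K : nat) :
  (forall k, (1 <= k)%N -> L - Cg / k%:R <= X k.+1 - X k) ->
  0 < b <= 1 -> exists2 K', (K <= K')%N & forall w N, 0 < w -> (K' <= N)%N ->
  let mu := critical_constant p L w in
  (forall k, (1 <= k <= N)%N -> 0 < riccati p lam mu k) ->
  exists2 k, (K <= k <= K')%N & v mu k <= b.
Proof.
move=> gapO /andP[b0 b1]; have p2 := p_ge2.
have [C C0 [K1 K11 step]] := riccati_step gapO.
pose s0 := b ^+ 2 / 8.
have s00 : 0 < s0 by rewrite divr_gt0// exprn_gt0.
have Ws : 0 < W * s0 by rewrite mulr_gt0.
(* from K2 on, half of the drift absorbs the error term *)
have [K2 hK2] := normalized_sum_large (2 * C / (W * s0)).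
have a0 : 0 < W * s0 / 2 by rewrite divr_gt0.
have [K' KK' desc] := descent (d^-1 / W `^ (p - 1)) b (K + K1 + K2) a0.
exists K' => [|w N w0 K'N mu z0].
  by apply: leq_trans KK'; rewrite -addnA leq_addr.
have mu0 : 0 < mu by exact: (critical_constant_gt0 p_ge2 L_bounds).
have pos k : (K + K1 + K2 <= k)%N -> (1 <= k)%N.
  by apply: leq_trans; rewrite addnAC ltn_addl.
have [k /andP[Kk kK'] vk] : exists2 k, (K + K1 + K2 <= k <= K')%N & v mu k <= b.
  apply: desc => [|k /andP[Kk kK'] vk].
    apply: le_trans (_ : riccati p lam mu (K + K1 + K2) / W `^ (p - 1) <= _).
      by rewrite gerBl.
    rewrite ler_wpM2r ?invr_ge0 ?powR_ge0//.
    by apply: (riccati_le mu0 z0); rewrite pos// (leq_trans KK').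
  have kN : (k < N)%N by exact: leq_trans K'N.
  have K1k : (K1 <= k < N)%N.
    by rewrite kN andbT (leq_trans _ Kk)// addnAC leq_addl.
  have vk1 : -1 <= v mu k by lra.
  apply: le_trans (step w N w0 z0 k K1k) _; rewrite -/mu.
  have K2k : (K2 <= k)%N by rewrite (leq_trans _ Kk)// leq_addl.
  have := hK2 k K2k; set Y := X k.+1 => hY.
  have Y0 : 0 < Y.
    have dk : 0 <= d * k%:R by rewrite mulr_ge0// ltW.
    by have := Xge k; rewrite -/Y; lra.
  have sv : s0 <= speed p (v mu k).
    have b1' : -1 <= b by lra.
    have sb : s0 <= speed p b by apply: speed_ge => //; rewrite ger0_norm// ltW.
    have n1 : (-1 : R) <= 0 by lra.
    have slope : 0 <= speed_slope p b.
      have := speed_ge_tangent p_ge2 n1 b1'; rewrite speed0 => h.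
      have : 0 <= speed_slope p b * b by lra.
      by rewrite pmulr_lge0.
    have vb : 0 <= v mu k - b by lra.
    have := speed_ge_tangent p_ge2 vk1 b1'; have := mulr_ge0 slope vb; lra.
  have WY : 0 <= W / Y by rewrite divr_ge0// ltW.
  have e1 : C / Y ^+ 2 <= W * s0 / 2 / Y.
    have -> : C / Y ^+ 2 = C / Y / Y by field; rewrite gt_eqF.
    rewrite ler_wpM2r ?invr_ge0 ?(ltW Y0)// ler_pdivrMr//.
    by move: hY; rewrite ler_pdivrMr//; lra.
  have e2 : W / Y * s0 <= W / Y * (quad_coef p * w ^+ 2 + speed p (v mu k)).
    rewrite ler_wpM2l//; apply: le_trans sv _.
    by rewrite lerDr mulr_ge0 ?(ltW k0)// sqr_ge0.
  move: e1 e2; have -> : W * s0 / 2 / Y = W / Y * s0 / 2 by field; rewrite gt_eqF.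
  by set A := W / Y * _; set B := W / Y * _; set D := C / _; lra.
by exists k => //; rewrite kK' andbT (leq_trans _ Kk)// -addnA leq_addr.
Qed.

Lemma step_sum_ge (K' : nat) : exists2 B, 0 <= B & forall k1 N,
  (k1 <= K')%N -> (k1 <= N)%N -> (1 <= N)%N ->
  W / L * ln N%:R - B <= \sum_(j < N - k1)
    W / X (k1 + j).+1 * (1 - p * (W / X (k1 + j).+1)).
Proof.
have p2 := p_ge2; have /andP[L0 L1] := L_bounds.
have Wb := fixed_ratio_bounds p_ge2 L_bounds; rewrite -/W in Wb.
have d1 : d <= 1.
  by have := gap_lb (ltn0Sn 0); have := gap_ub (ltn0Sn 0); lra.
have WL : 0 <= W / L by rewrite divr_ge0 ?ltW.
have pd : 0 <= p / d ^+ 2 by rewrite divr_ge0 ?sqr_ge0//; lra.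
have arg k : 0 < 1 + L * k%:R by rewrite ltr_wpDr// mulr_ge0// ltW.
exists (W / L * (ln (1 + L * K'%:R) - ln L) + p / d ^+ 2 * 2).
  rewrite addr_ge0 ?(mulr_ge0 pd)// mulr_ge0// subr_ge0.
  rewrite ler_ln ?posrE//.
  have : 0 <= L * K'%:R by rewrite mulr_ge0// ltW.
  by lra.
move=> k1 N k1K' k1N N1.
have hlow j : W * (1 + L * (k1 + j)%:R)^-1 - p / d ^+ 2 * (j.+1%:R ^+ 2)^-1
    <= W / X (k1 + j).+1 * (1 - p * (W / X (k1 + j).+1)).
  have dk : 0 <= d * k1%:R by rewrite mulr_ge0// ltW.
  have dj : 0 < d * j.+1%:R by rewrite mulr_gt0 ?ltr0n.
  have := Xge (k1 + j); have := Xle (k1 + j).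
  set Y := X _ => Yle Yge.
  have Ydj : d * j.+1%:R <= Y.
    by apply: le_trans Yge; rewrite -natr1 natrD; lra.
  have Y0 : 0 < Y by lra.
  have -> : W / Y * (1 - p * (W / Y)) = W / Y - p * (W / Y) ^+ 2 by ring.
  apply: lerB.
    by rewrite ler_wpM2l ?(ltW W0)// lef_pV2 ?posrE.
  rewrite -mulrA ler_wpM2l//; first by lra.
  have WY : 0 <= W / Y by rewrite divr_ge0// ltW.
  rewrite -invfM -exprMn -exprVn lerXn2r ?nnegrE ?invr_ge0 ?(ltW dj)//.
  rewrite ler_pdivrMr// mulrC ler_pdivlMr//.
  by apply: le_trans Ydj; rewrite ler_piMl ?(ltW dj)//; lra.
apply: le_trans (ler_sum _ (fun (k : 'I__) _ => hlow k)).
rewrite big_split/= sumrN -!mulr_sumr.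
have s1 := sum_inv_affine_ge (N - k1) k1 L0; rewrite subnKC// in s1.
have s2 := sum_inv_sqr_le (R := R) (N - k1).
have := ler_wpM2l pd s2; have := ler_wpM2l (ltW W0) s1.
have l1 : ln L + ln N%:R <= ln (1 + L * N%:R).
  have NR : 0 < N%:R :> R by rewrite ltr0n.
  have LN : 0 < L * N%:R by rewrite mulr_gt0.
  by rewrite -lnM ?posrE// ler_ln ?posrE ?lerDr.
have l2 : ln (1 + L * k1%:R) <= ln (1 + L * K'%:R).
  by rewrite ler_ln ?posrE// lerD2l ler_wpM2l ?(ltW L0)// ler_nat.
have : W / L * (ln N%:R - (ln (1 + L * K'%:R) - ln L)) <=
    W / L * (ln (1 + L * N%:R) - ln (1 + L * k1%:R)).
  by rewrite ler_wpM2l//; lra.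
rewrite mulrA.
set WL' := W / L; set pd' := p / _; set S1 := \sum_(_ < _) _.
by set S2 := \sum_(_ < _) _; lra.
Qed.

(** For a smaller constant the orbit would stay positive up to [N]; after the
    shift it is an Euler supersolution from a bounded index on, so by
    [euler_extinction] its steps would not add up to more than the total travel
    time. *)
Lemma hardy_constant_ge (Cg : R) :
  (forall k, (1 <= k)%N -> L - Cg / k%:R <= X k.+1 - X k) ->
  exists C, exists N0 : nat, forall N c, (N0 <= N)%N ->
    hardy_constants p lam N c -> critical_constant p L (width p L (- C) N) <= c.
Proof.
move=> gapO; have /andP[L0 L1] := L_bounds.
have [C C0 [K1 K11 step]] := riccati_shifted_step gapO.
have [M M0 hM] := euler_extinction p_ge2.
pose b := d / (4 * p).
have b0 : 0 < b by rewrite divr_gt0// mulr_gt0// (lt_le_trans _ p_ge2).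
have b1 : b <= 1.
  have : d <= 1 by have := gap_lb (ltn0Sn 0); have := gap_ub (ltn0Sn 0); lra.
  by have p2 := p_ge2; rewrite ler_pdivrMr; lra.
(* from K2 on, the shift is at most half of the allowed position *)
have [K2 hK2] := normalized_sum_large (2 * C / b).
have b2 : 0 < b / 2 <= 1 by apply/andP; split; lra.
have [K' KK' reach] := riccati_reaches (K1 + K2) gapO b2.
have [B B0 hB] := step_sum_ge K'.
pose T := (B + M + 1) * L / W.
exists (B + M + 1); exists (maxn K' (Num.bound (expR T)).+1) => N c.
rewrite geq_max => /andP[K'N NT] hc.
have N0 : (1 <= N)%N by exact: leq_trans NT.
pose E := W / L * ln N%:R - (B + M + 1).
have E0 : 0 < E.
  have h : expR T < N%:R.
    by apply: lt_trans (archi_boundP (expR_ge0 T)) _; rewrite ltr_nat.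
  have : T < ln N%:R by rewrite -[ltLHS]expRK ltr_ln ?posrE ?expR_gt0 ?ltr0n.
  rewrite ltr_pdivrMr// => h'; rewrite subr_gt0.
  have -> : W / L * ln N%:R = ln N%:R * W / L by ring.
  by rewrite ltr_pdivlMr.
set w := width _ _ _ _; have wE : w = pi / (quad_coef p * E) by [].
have w0 : 0 < w by rewrite wE divr_gt0 ?pi_gt0// (mulr_gt0 k0 E0).
pose mu := critical_constant p L w; rewrite -/mu leNgt; apply/negP => cmu.
have mu0 : 0 < mu by exact: (critical_constant_gt0 p_ge2 L_bounds).
have z0 k : (1 <= k <= N)%N -> 0 < riccati p lam mu k.
  exact: (riccati_gt0 p_ge2 lam_gt0 mu0 hc cmu).
have [k1 /andP[Kk1 k1K'] vk1] := reach w N w0 K'N z0.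
have K1k1 : (K1 <= k1)%N by exact: leq_trans (leq_addr _ _) Kk1.
have K2k1 : (K2 <= k1)%N by exact: leq_trans (leq_addl _ _) Kk1.
have k1N : (k1 <= N)%N by exact: leq_trans K'N.
have X0 k : 0 < X k.+1.
  apply: lt_le_trans (Xge k); rewrite ltr_wpDr// mulr_ge0// ltW//.
have CX k : 0 <= C / X k.+1 by rewrite divr_ge0// ltW.
pose u j := v mu (k1 + j) + C / X (k1 + j).+1.
pose n := (N - k1)%N; have k1n : (k1 + n)%N = N by rewrite subnKC.
pose h j := W / X (k1 + j).+1.
have h0 j : 0 <= h j by rewrite divr_ge0// ltW.
have u1 j : (j <= n)%N -> -1 <= u j.
  move=> jn; have zj : 0 < riccati p lam mu (k1 + j).
    have kjN : (k1 + j <= N)%N by rewrite -k1n leq_add2l.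
    by apply: z0; rewrite kjN andbT ltn_addr// (leq_trans K11).
  have : 0 <= riccati p lam mu (k1 + j) / W `^ (p - 1).
    by rewrite divr_ge0 ?powR_ge0// ltW.
  by have := CX (k1 + j)%N; rewrite /u /v; lra.
have us j : (j < n)%N -> u j <= b ->
    u j.+1 <= u j - h j * (quad_coef p * w ^+ 2 + speed p (u j)).
  move=> jn uj; rewrite {1}/u addnS.
  have kj : (K1 <= k1 + j < N)%N.
    by rewrite -[ltnRHS]k1n ltn_add2l jn andbT (leq_trans _ (leq_addr _ _)).
  exact: step w N w0 z0 _ kj uj.
have ub j : (j <= n)%N -> u j <= b.
  elim: j => [_|j IH jn].
    rewrite /u addn0 (splitr b); apply: lerD => //.
    have := hK2 k1 K2k1; rewrite !ler_pdivrMr//.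
    by rewrite -/X; lra.
  have uj := IH (ltnW jn); apply: le_trans (us j jn uj) _.
  apply: le_trans uj; rewrite gerBl mulr_ge0// addr_ge0//.
    by rewrite mulr_ge0 ?(ltW k0)// sqr_ge0.
  by apply: (speed_ge0 p_ge2); exact: u1 (ltnW jn).
have u2 j : (j <= n)%N -> -1 <= u j <= 1.
  by move=> jn; rewrite u1//= (le_trans (ub j jn)).
have := hM w h u n w0 h0 u2 (fun j jn => us j jn (ub j (ltnW jn))).
have := hB k1 N k1K' k1N N0; rewrite wE (passage_timeK p_ge2 E0) -/n.
by rewrite /h /E; set S := \sum_(_ < _) _; lra.
Qed.

End Extinction.

(** * The expansion *)

Section Expansion.
Context {R : realType}.
Implicit Types A C l : R.

Lemma inv_one_plus_expansion A C : 0 <= A -> exists2 D, 0 <= D & forall l,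
  1 <= l -> 2 * `|C| <= l ->
  `|(1 + A / (l + C) ^+ 2)^-1 - (1 - A / l ^+ 2)| <= D / l ^+ 3.
Proof.
move=> A0; exists (10 * A * `|C| + 16 * A ^+ 2) => [|l l1 lC].
  by rewrite addr_ge0 ?mulr_ge0 ?sqr_ge0.
have l0 : 0 < l by lra.
have /andP[C1 C2] : - `|C| <= C <= `|C| by rewrite -ler_norml.
have s0 : 0 < l + C by lra.
set s := l + C in s0 *.
have sl : l / 2 <= s by rewrite /s; lra.
have l2 : 0 < l ^+ 2 by rewrite exprn_gt0.
have l3 : 0 < l ^+ 3 by rewrite exprn_gt0.
have s2 : 0 < s ^+ 2 by rewrite exprn_gt0.
have sl2 : l ^+ 2 / 4 <= s ^+ 2.
  have -> : l ^+ 2 / 4 = (l / 2) ^+ 2 by field.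
  have hl : 0 <= l / 2 by lra.
  by rewrite lerXn2r ?nnegrE ?(ltW s0).
pose e := A / s ^+ 2.
have e0 : 0 <= e by rewrite divr_ge0// ltW.
have -> : (1 + A / s ^+ 2)^-1 - (1 - A / l ^+ 2) =
    e ^+ 2 / (1 + e) + A * (s ^+ 2 - l ^+ 2) / (l ^+ 2 * s ^+ 2).
  have e1 : 1 + e != 0 by rewrite gt_eqF//; lra.
  have -> : A / l ^+ 2 = e + A * (s ^+ 2 - l ^+ 2) / (l ^+ 2 * s ^+ 2).
    by rewrite /e; field; rewrite !gt_eqF.
  have alg (x u : R) : 1 + x != 0 ->
      (1 + x)^-1 - (1 - (x + u)) = x ^+ 2 / (1 + x) + u by move=> ?; field.
  by rewrite -/e alg.
rewrite mulrDl addrC; apply: le_trans (ler_normD _ _) _; apply: lerD.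
  have ls : 0 < l ^+ 2 * s ^+ 2 by rewrite mulr_gt0.
  rewrite normrM (gtr0_norm (_ : 0 < (l ^+ 2 * s ^+ 2)^-1)) ?invr_gt0//.
  rewrite ler_pdivrMr//.
  have -> : s ^+ 2 - l ^+ 2 = C * (2 * l + C) by rewrite /s; ring.
  rewrite normrM (ger0_norm A0) normrM.
  have n1 : `|2 * l + C| <= 5 / 2 * l.
    by rewrite ler_norml; apply/andP; split; lra.
  apply: le_trans (_ : A * (`|C| * (5 / 2 * l)) <= _).
    by rewrite ler_wpM2l// ler_wpM2l.
  have -> : 10 * A * `|C| / l ^+ 3 * (l ^+ 2 * s ^+ 2) =
      A * (`|C| * (10 / l * s ^+ 2)) by field; rewrite gt_eqF.
  rewrite ler_wpM2l// ler_wpM2l//.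
  apply: le_trans (_ : 10 / l * (l ^+ 2 / 4) <= _); last first.
    by rewrite ler_wpM2l// divr_ge0// ltW.
  by rewrite le_eqVlt; apply/orP; left; apply/eqP; field; rewrite gt_eqF.
rewrite ger0_norm; last by rewrite divr_ge0 ?sqr_ge0//; lra.
have el : e <= 4 * A / l ^+ 2.
  have -> : 4 * A / l ^+ 2 = A / (l ^+ 2 / 4) by field; rewrite gt_eqF.
  by rewrite ler_wpM2l// lef_pV2 ?posrE// divr_gt0.
apply: le_trans (_ : e ^+ 2 <= _).
  by rewrite ler_pdivrMr; [rewrite ler_peMr ?sqr_ge0//; lra|lra].
apply: le_trans (_ : (4 * A / l ^+ 2) ^+ 2 <= _).
  by rewrite lerXn2r ?nnegrE// divr_ge0 ?(ltW l2)// mulr_ge0.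
have -> : (4 * A / l ^+ 2) ^+ 2 = 16 * A ^+ 2 / l ^+ 3 * l^-1.
  by field; rewrite gt_eqF.
rewrite ler_piMr ?invf_le1// divr_ge0 ?(ltW l3)//.
by rewrite mulr_ge0 ?sqr_ge0.
Qed.

End Expansion.

Section Regularity.
Context {R : realType} {lam : nat -> R}.
Context (lam_gt0 : forall k, (1 <= k)%N -> 0 < lam k).
Context {L d : R} (L_bounds : 0 < L <= 1) (d_gt0 : 0 < d).

Let X := normalized_sum lam.

Context (gap_lb : forall k, (1 <= k)%N -> d <= X k.+1 - X k).
Context (gap_ub : forall k, (1 <= k)%N -> X k.+1 - X k <= L).

Let Xge n : 1 + d * n%:R <= X n.+1 := normalized_sum_ge lam_gt0 gap_lb n.
Let Xle n : X n.+1 <= 1 + L * n%:R := normalized_sum_le lam_gt0 gap_ub n.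

Lemma normalized_sum_bounds k : (1 <= k)%N -> 0 < X k <= k%:R.
Proof.
case: k => // k _; have := Xge k; have := Xle k.
have dk : 0 <= d * k%:R by rewrite mulr_ge0// ltW.
have /andP[L0 L1] := L_bounds.
have := ler_wpM2r (ler0n R k) L1.
by rewrite -(natr1 k) => h1 h2 h3; apply/andP; split; lra.
Qed.

(** Inverting the expansion of [lam k / partial_sum lam k] gives
    [X k = L * k + O(1)]. *)
Lemma normalized_sum_ge_linear :
  (fun k : nat => lam k / partial_sum lam k) =
  (fun k : nat => 1 / (L * k%:R)) +O_\oo (fun k : nat => 1 / k%:R ^+ 2 : R) ->
  exists C, forall k, (1 <= k)%N -> L * k%:R - C <= X k.+1.
Proof.
move=> /eqaddOP/bigO_exP[C C0 [K _ hK]].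
have /andP[L0 L1] := L_bounds.
exists (C + K%:R) => k k1.
have /andP[Xk0 Xkk] := normalized_sum_bounds k1.
have kp : 0 < k%:R :> R by rewrite ltr0n.
have Xk : X k <= X k.+1 by have := gap_lb k1; have dd := d_gt0; lra.
have [kK|Kk] := leqP K k; last first.
  have kK : k%:R <= K%:R :> R by rewrite ler_nat ltnW.
  have := ler_wpM2r (ler0n R k) L1; lra.
have := hK k kK; rewrite /= -[(_ - _) k]/(_ k - _ k).
have -> : lam k / partial_sum lam k = (X k)^-1 by rewrite /X /normalized_sum invf_div.
rewrite ler_norml => /andP[_].
have k2 : 0 < k%:R ^+ 2 :> R by rewrite exprn_gt0.
rewrite ger0_norm; last by rewrite divr_ge0// ltW.
set m := k%:R in kp Xkk k2 *.
rewrite -subr_ge0.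
have -> : C * (1 / m ^+ 2) - ((X k)^-1 - 1 / (L * m)) =
    (C * (L * X k) - m * (L * m - X k)) / (m ^+ 2 * L * X k).
  by field; rewrite !gt_eqF.
rewrite pmulr_lge0 ?invr_gt0 ?(mulr_gt0 (mulr_gt0 k2 L0) Xk0)// subr_ge0 => h.
have LX : L * X k <= m.
  by have := ler_wpM2r (ltW Xk0) L1; lra.
have := ler_wpM2l (ltW C0) LX => h'.
have : L * m - X k <= C by rewrite -(ler_pM2l kp); lra.
have := ler0n R K; lra.
Qed.

(** From [X k.+1 = 1 + X k * (lam k / lam k.+1)]; the bound
    [X k <= 1 + L * (k - 1)] suffices for the error terms. *)
Lemma normalized_sum_gap_ge :
  (fun k : nat => lam k / lam k.+1) =
  (fun k : nat => 1 - (1 / L - 1) / k%:R) +O_\oo (fun k : nat => 1 / k%:R ^+ 2 : R) ->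
  exists C, forall k, (1 <= k)%N -> L - C / k%:R <= X k.+1 - X k.
Proof.
move=> /eqaddOP/bigO_exP[C C0 [K _ hK]].
have /andP[L0 L1] := L_bounds.
pose B := (1 - L) * (L^-1 - 1).
have B0 : 0 <= B by rewrite mulr_ge0// ?subr_ge0// invf_ge1.
exists (B + C + K%:R) => k k1.
have /andP[Xk0 Xkk] := normalized_sum_bounds k1.
have kp : 0 < k%:R :> R by rewrite ltr0n.
have K0 : 0 <= K%:R :> R by [].
have dd := d_gt0; have g := gap_lb k1.
have [kK|Kk] := leqP K k; last first.
  have kK : k%:R <= K%:R :> R by rewrite ler_nat ltnW.
  have : L <= (B + C + K%:R) / k%:R.
    by rewrite ler_pdivlMr//; have := ler_wpM2r (ltW kp) L1; lra.
  by lra.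
have := hK k kK; rewrite /= -[(_ - _) k]/(_ k - _ k).
rewrite ler_norml => /andP[+ _].
have k2 : 0 < k%:R ^+ 2 :> R by rewrite exprn_gt0.
rewrite ger0_norm; last by rewrite divr_ge0// ltW.
have XE : X k.+1 - 1 = X k * (lam k / lam k.+1).
  have l0 := lam_gt0 k1; have l1 := lam_gt0 (ltn0Sn k).
  rewrite normalized_sum_sub1// /X /normalized_sum.
  by field; rewrite !gt_eqF.
have Xk1 : X k <= 1 - L + L * k%:R.
  case: k k1 {kK Xk0 Xkk kp g k2 XE} => // k _.
  by have := Xle k; rewrite -(natr1 k); lra.
set r := lam k / lam k.+1 in XE *; set m := k%:R in kp Xkk k2 Xk1 *.
move=> h.
have h1 : 1 - (L^-1 - 1) / m - C / m ^+ 2 <= r.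
  by move: h; rewrite !div1r; set a := _ / m; set b := C / _; lra.
have h2 := ler_wpM2l (ltW Xk0) h1.
have e1 : X k * (C / m ^+ 2) <= C / m.
  have -> : C / m = m * (C / m ^+ 2) by field; rewrite gt_eqF.
  by rewrite ler_wpM2r// divr_ge0 ?(ltW C0)// ltW.
have Li : 0 <= L^-1 - 1 by rewrite subr_ge0 invf_ge1.
have e2 : X k * ((L^-1 - 1) / m) <= (1 - L) + B / m.
  have -> : 1 - L + B / m = (1 - L + L * m) * ((L^-1 - 1) / m).
    by rewrite /B; field; rewrite !gt_eqF.
  by rewrite ler_wpM2r// divr_ge0// ltW.
have e3 : 0 <= K%:R / m by rewrite divr_ge0// ltW.
have e4 : (B + C + K%:R) / m = B / m + C / m + K%:R / m by rewrite !mulrDl.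
rewrite e4; move: h2 e1 e2 e3; rewrite -XE !mulrBr.
set a1 := X k * (C / _); set a2 := X k * (_ / m); set a3 := K%:R / m.
set a4 := B / m; set a5 := C / m.
by lra.
Qed.

End Regularity.

Lemma critical_constantE (R : realType) (p L C l : R) :
  2 <= p -> 0 < L <= 1 -> 0 < l -> 0 < fixed_ratio p L / L * l + C ->
  critical_constant p L (pi / (quad_coef p * (fixed_ratio p L / L * l + C))) =
  fixed_ratio p L `^ (- p) *
  (1 + (2 * L ^+ 2 * pi ^+ 2 / (conj_exp p * fixed_ratio p L ^+ 2)) /
       (l + C * L / fixed_ratio p L) ^+ 2)^-1.
Proof.
move=> p2 Lb l0; have /andP[L0 L1] := Lb.
have q1 := conj_exp_bounds p2; have W1 := fixed_ratio_bounds p2 Lb.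
rewrite /critical_constant /quad_coef powRN.
move: (fixed_ratio p L) (conj_exp p) W1 q1 => W q W1 q1 E0.
rewrite invfM; congr (_ * (1 + _)^-1).
have W0 : 0 < W by lra.
have E1 : 0 < W * l + C * L.
  have -> : W * l + C * L = (W / L * l + C) * L by field; rewrite gt_eqF.
  by rewrite mulr_gt0.
move: (pi : R) => P.
by field; rewrite !gt_eqF//; lra.
Qed.

Theorem theorem1p1 (R : realType) (p q : R) (lam : nat -> R) (L : R)
  (hp : 2 <= p)
  (hq : 1 / p + 1 / q = 1)
  (hpos : forall k, (1 <= k)%N -> 0 < lam k)
  (hmono : forall k, (1 <= k)%N -> lam k <= lam k.+1)
  (hL : ereal_sup [set (ratio_gap lam n)%:E | n in [set n | (1 <= n)%N]] = L%:E)
  (hi : L <= 1)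
  (hii : (ereal_sup [set (lam k.+1 / lam k)%:E | k in [set k | (1 <= k)%N]]
          < +oo)%E)
  (hiii : (fun k : nat => lam k / lam k.+1)
          = (fun k : nat => 1 - (1 / L - 1) / k%:R)
            +O_\oo (fun k : nat => 1 / k%:R ^+ 2 : R))
  (hiv : (fun k : nat => lam k / partial_sum lam k)
         = (fun k : nat => 1 / (L * k%:R))
           +O_\oo (fun k : nat => 1 / k%:R ^+ 2 : R))
  (hv : (0 < ereal_inf [set (ratio_gap lam k)%:E | k in [set k | (1 <= k)%N]])%E)
  (hvi : forall k, (1 <= k)%N ->
     1 - L / p >=
     partial_sum lam k / lam k *
       (1 - (partial_sum lam k / partial_sum lam k.+1) `^ ((p - 1) / p)
            * (lam k / lam k.+1) `^ (1 / p))) :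
  (fun N : nat => best_hardy_constant p lam N)
  = (fun N : nat =>
       (1 - L / p) `^ (- p)
       - 2 * L ^+ 2 * pi ^+ 2 * (1 - L / p) `^ (- 2 - p)
         / (q * ln N%:R ^+ 2))
    +O_\oo (fun N : nat => 1 / ln N%:R ^+ 3 : R).
Proof.
pose X := normalized_sum lam.
have gap_ub k : (1 <= k)%N -> X k.+1 - X k <= L.
  by move=> k1; rewrite -lee_fin -hL; apply: ereal_sup_ubound; exists k.
have [d d0 gap_lb] : exists2 d, 0 < d & forall k, (1 <= k)%N -> d <= X k.+1 - X k.
  have lb k : (1 <= k)%N -> (ereal_inf [set (ratio_gap lam k)%:E | k in
      [set k | (1 <= k)%N]] <= (X k.+1 - X k)%:E)%E.
    by move=> k1; apply: ereal_inf_lbound; exists k.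
  move: hv lb; case: (ereal_inf _) => [r| |] // r0 lb.
    by exists r => // k /lb; rewrite lee_fin.
  by have := lb 1%N isT.
have L0 : 0 < L by have := gap_lb 1%N isT; have := gap_ub 1%N isT; lra.
have Lb : 0 < L <= 1 by rewrite L0.
have [Cx hCx] := normalized_sum_ge_linear hpos Lb d0 gap_lb gap_ub hiv.
have [Cg hCg] := normalized_sum_gap_ge hpos Lb d0 gap_lb gap_ub hiii.
have [C1 _ up] := hardy_constant_le hp hpos Lb d0 gap_lb gap_ub hCx.
have [C2 [N0 low]] := hardy_constant_ge hp hpos Lb d0 gap_lb gap_ub hCg.
have Wb := fixed_ratio_bounds hp Lb.
have qE : q = conj_exp p.
  have : q^-1 = (p - 1) / p.
    rewrite -div1r; have -> : 1 / q = 1 - 1 / p by rewrite -(addKr (1 / p) (1 / q)) hq addrC.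
    by field; rewrite gt_eqF//; lra.
  by move=> /(congr1 (@GRing.inv R)); rewrite invrK invf_div.
set W := fixed_ratio p L in Wb *.
have W0 : 0 < W by lra.
have q0 : 0 < q by rewrite qE; have := conj_exp_bounds hp; lra.
pose A := 2 * L ^+ 2 * pi ^+ 2 / (q * W ^+ 2).
have A0 : 0 <= A.
  by apply: divr_ge0; apply: mulr_ge0; rewrite ?sqr_ge0 ?(ltW q0)// mulr_ge0// sqr_ge0.
have [D1 D10 h1] := inv_one_plus_expansion (C1 * L / W) A0.
have [D2 D20 h2] := inv_one_plus_expansion (- C2 * L / W) A0.
pose P := W `^ (- p).
have P0 : 0 < P by exact: powR_gt0.
apply/eqaddOP/bigO_exP; exists (P * (D1 + D2 + 1)).
  by rewrite mulr_gt0//; lra.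
pose T := 1 + 2 * (`|C1 * L / W| + `|- C2 * L / W|).
have T0 : 0 <= expR T by exact: expR_ge0.
exists (maxn N0 (Num.bound (expR T)).+1) => // N /=; rewrite geq_max => /andP[NN0 NT].
have N1 : (1 <= N)%N by exact: leq_trans NT.
set l : R := ln N%:R.
have lT : T <= l.
  rewrite -[leLHS]expRK ler_ln ?posrE ?expR_gt0 ?ltr0n//.
  by apply: ltW; apply: lt_trans (archi_boundP T0) _; rewrite ltr_nat.
have T1 : 1 <= T by rewrite lerDl mulr_ge0// addr_ge0.
have n1 := normr_ge0 (C1 * L / W); have n2 := normr_ge0 (- C2 * L / W).
have l1 : 1 <= l by lra.
have l0 : 0 < l by lra.
have lC1 : 2 * `|C1 * L / W| <= l by rewrite /T in lT; lra.
have lC2 : 2 * `|- C2 * L / W| <= l by rewrite /T in lT; lra.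
have pos C : 2 * `|C * L / W| <= l -> 0 < W / L * l + C.
  move=> lC; have -> : W / L * l + C = W / L * (l + C * L / W).
    by field; rewrite !gt_eqF.
  rewrite mulr_gt0 ?divr_gt0//.
  have : - `|C * L / W| <= C * L / W by rewrite lerNl -normrN ler_norm.
  by have := normr_ge0 (C * L / W); set x := C * L / W; lra.
have [bP bmin] := best_hardy_constantP (lt_le_trans (ltr0n R 2) hp) hpos N1.
set b := best_hardy_constant p lam N in bP bmin *.
have u := bmin _ (up N N1); have lo := low N b NN0 bP.
move: u lo; rewrite /width -/l -/W.
rewrite !critical_constantE// ?pos// -/W -qE -/A -/P => u lo.
have /ler_normlP[_ u'] := h1 l l1 lC1; have /ler_normlP[lo' _] := h2 l l1 lC2.
have P0' := ltW P0.
have u2 := ler_wpM2l P0' u'; have lo2 := ler_wpM2l P0' lo'.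
rewrite -[(_ - _) N]/(b - _).
rewrite -/l -[1 - L / p]/W.
have -> : W `^ (- p) - 2 * L ^+ 2 * pi ^+ 2 * W `^ (- 2 - p) / (q * l ^+ 2) =
    P * (1 - A / l ^+ 2).
  rewrite powRD; last by apply/implyP => _; rewrite gt_eqF.
  rewrite (powR_invn 2 (ltW W0)) -/P /A.
  by move: (pi : R) => x; field; rewrite !gt_eqF.
have li : 0 <= l ^- 3 by rewrite invr_ge0 exprn_ge0 ?(ltW l0).
rewrite div1r (ger0_norm li).
have PD1 : 0 <= P * (D1 * l ^- 3) by rewrite !mulr_ge0.
have PD2 : 0 <= P * (D2 * l ^- 3) by rewrite !mulr_ge0.
have PD3 : 0 <= P * l ^- 3 by rewrite mulr_ge0.
move: u lo u2 lo2 PD1 PD2 PD3; set i3 := l ^- 3; set AA := A / _.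
set i1 := (1 + _)^-1; set i2 := (1 + _)^-1.
by move=> *; rewrite ler_norml; apply/andP; split; lra.
Qed.
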